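(* Let $\Omega\subset\hat{\mathbb{C}}$ be an $L$-John domain with $\partial\Omega$ connected. Then every weak tangent of $\partial\Omega$ has at most $N$ connected components, where $N<\infty$ depends only on $L$.
   Context: The Riemann sphere $\hat{\mathbb{C}}$ and all its subsets (in particular $\partial\Omega$) carry the spherical metric. A domain is a connected open set. $B(x,r)$ denotes the open metric ball. John domains: for a domain $\Omega \subset \hat{\mathbb{C}}$ and $z \in \Omega$, let $\delta_\Omega(z) = \mathrm{dist}(z,\partial\Omega)$. For an arc $\alpha$ and $z,z' \in \alpha$, $\alpha[z,z']$ denotes the closed sub-arc joining $z$ and $z'$. For $L \ge 1$, an arc $\alpha \subset \Omega$ with endpoints $z_0, z_1$ is an $L$-John arc with base-point $z_0$ and tip $z_1$ if $\mathrm{diam}(\alpha[z,z_1]) \le L\,\delta_\Omega(z)$ for every $z \in \alpha$. $\Omega$ is an $L$-John domain if there is $z_0 \in \Omega$ such that every $z \in \Omega$ can be joined to $z_0$ by an $L$-John arc with base-point $z_0$ and tip $z$. Gromov-Hausdorff convergence: pointed metric spaces $(X_n,d_n,p_n)$ converge to $(Y,d',p)$ in the Gromov-Hausdorff sense if for every $\epsilon>0$ and $R\ge 1$ there is $N_0\in\mathbb{N}$ such that for each $n\ge N_0$ there is a map $\phi_n: B(p_n,R)\to Y$ with (i) $\phi_n(p_n)=p$, (ii) $\phi_n(B(p_n,R))$ is $\epsilon$-dense in $B(p,R)$, and (iii) $|d_n(x,y)-d'(\phi_n(x),\phi_n(y))|<\epsilon$ for all $x,y\in B(p_n,R)$. Weak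 tangents: for a doubling metric space $(X,d)$ (there is a constant $D$ such that every ball of radius $r$ can be covered by at most $D$ balls of radius $r/2$), a complete pointed metric space $(Y,d',p)$ is a weak tangent of $X$ if there are points $p_n\in X$ and scales $\lambda_n>0$ with $\lambda_n\to 0$ such that $(X,\lambda_n^{-1}d,p_n)$ converge in the Gromov-Hausdorff sense to $(Y,d',p)$. *)

(* Defs.v *)
From HB Require Import structures.
From mathcomp Require Import all_boot all_order all_algebra.
From mathcomp Require Import complex ring lra.
From mathcomp Require Import boolp classical_sets cardinality reals ereal.
From mathcomp Require Import topology normedtype trigo.

Set Implicit Arguments.
Unset Strict Implicit.
Unset Printing Implicit Defensive.

Import Order.TTheory GRing.Theory Num.Theory.
Import numFieldNormedType.Exports.

Local Open Scope classical_set_scope.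
Local Open Scope ring_scope.

(* [None] is the point at infinity. *)
Definition riemann_sphere (R : realType) : Type := option R[i].

HB.instance Definition _ (R : realType) := 
  Choice.copy (riemann_sphere R) (option R[i]).

(* The inverse stereographic projection onto the unit sphere of R^3. *)
Definition stereo (R : realType) (z : riemann_sphere R) : R * R * R :=
  if z is Some (a +i* b)%C then
    let s := a ^+ 2 + b ^+ 2 in
    (2 * a / (s + 1), 2 * b / (s + 1), (s - 1) / (s + 1))
  else (0, 0, 1).

Definition dot3 (R : realType) (u v : R * R * R) : R :=
  u.1.1 * v.1.1 + u.1.2 * v.1.2 + u.2 * v.2.

(* The angle between the two points seen on the unit sphere, that is, the
   geodesic distance of the length element 2|dz|/(1+|z|^2). *)
Definition spherical_dist (R : realType) (z w : riemann_sphere R) : R :=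
  acos (dot3 (stereo z) (stereo w)).

Section SphericalMetric.
Variable R : realType.
Implicit Types (u v w : R * R * R) (x y z : riemann_sphere R).

Lemma stereo_unit z : dot3 (stereo z) (stereo z) = 1.
Proof.
case: z => [[a b]|]; rewrite /dot3 /=; last by ring.
have s0 : a ^+ 2 + b ^+ 2 + 1 != 0.
  by rewrite gt_eqF// ltr_wpDl// addr_ge0// sqr_ge0.
by field.
Qed.

Lemma stereo_inj : injective (@stereo R).
Proof.
have s0 (a b : R) : a ^+ 2 + b ^+ 2 + 1 != 0.
  by rewrite gt_eqF// ltr_wpDl// addr_ge0// sqr_ge0.
have coord (a b : R) : let s := a ^+ 2 + b ^+ 2 in
    1 - (s - 1) / (s + 1) = 2 / (s + 1).
  by move=> s; rewrite /s; field.
move=> [[a b]|] [[c d]|] //= [] e1 e2 e3.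
- have e : 2 / (a ^+ 2 + b ^+ 2 + 1) = 2 / (c ^+ 2 + d ^+ 2 + 1).
    by rewrite -!coord e3.
  have nz : 2 / (c ^+ 2 + d ^+ 2 + 1) != 0.
    by rewrite mulf_neq0 ?invr_eq0 ?pnatr_eq0.
  have -> : a = c.
    apply: (mulIf nz); rewrite -{1}e.
    by rewrite !mulrA ![_ * 2]mulrC.
  have -> // : b = d.
  apply: (mulIf nz); rewrite -{1}e.
  by rewrite !mulrA ![_ * 2]mulrC.
- have := coord a b; rewrite /= e3 subrr => /esym/eqP.
  by rewrite mulf_eq0 invr_eq0 (negbTE (s0 _ _)) pnatr_eq0.
- have := coord c d; rewrite /= -e3 subrr => /esym/eqP.
  by rewrite mulf_eq0 invr_eq0 (negbTE (s0 _ _)) pnatr_eq0.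
Qed.

Lemma dot3C u v : dot3 u v = dot3 v u.
Proof. by rewrite /dot3; ring. Qed.

Lemma gram3_ge0 u v w : dot3 u u = 1 -> dot3 v v = 1 -> dot3 w w = 1 ->
  (dot3 u v * dot3 v w - dot3 u w) ^+ 2 <=
  (1 - dot3 u v ^+ 2) * (1 - dot3 v w ^+ 2).
Proof.
move=> u1 v1 w1; rewrite -subr_ge0.
have -> : (1 - dot3 u v ^+ 2) * (1 - dot3 v w ^+ 2) -
    (dot3 u v * dot3 v w - dot3 u w) ^+ 2 =
    dot3 u u * dot3 v v * dot3 w w + 2 * dot3 u v * dot3 v w * dot3 u w
    - dot3 u u * dot3 v w ^+ 2 - dot3 v v * dot3 u w ^+ 2
    - dot3 w w * dot3 u v ^+ 2.
  by rewrite u1 v1 w1; ring.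
have -> : dot3 u u * dot3 v v * dot3 w w + 2 * dot3 u v * dot3 v w * dot3 u w
    - dot3 u u * dot3 v w ^+ 2 - dot3 v v * dot3 u w ^+ 2
    - dot3 w w * dot3 u v ^+ 2 =
    (u.1.1 * (v.1.2 * w.2 - v.2 * w.1.2)
     - u.1.2 * (v.1.1 * w.2 - v.2 * w.1.1)
     + u.2 * (v.1.1 * w.1.2 - v.1.2 * w.1.1)) ^+ 2.
  by rewrite /dot3; ring.
exact: sqr_ge0.
Qed.

Lemma dot3_itv u v : dot3 u u = 1 -> dot3 v v = 1 -> -1 <= dot3 u v <= 1.
Proof.
move=> u1 v1.
have := sqr_ge0 (u.1.1 - v.1.1); have := sqr_ge0 (u.1.2 - v.1.2).
have := sqr_ge0 (u.2 - v.2); have := sqr_ge0 (u.1.1 + v.1.1).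
have := sqr_ge0 (u.1.2 + v.1.2); have := sqr_ge0 (u.2 + v.2).
by move: u1 v1; rewrite /dot3 => u1 v1 *; apply/andP; split; nra.
Qed.

Lemma spherical_distxx z : spherical_dist z z = 0.
Proof. by rewrite /spherical_dist stereo_unit acos1. Qed.

Lemma spherical_dist_sym x y : spherical_dist x y = spherical_dist y x.
Proof. by rewrite /spherical_dist dot3C. Qed.

Lemma spherical_dist_eq0 x y : spherical_dist x y = 0 -> x = y.
Proof.
rewrite /spherical_dist => h; apply: stereo_inj.
have := stereo_unit x; have := stereo_unit y.
have hi := dot3_itv (stereo_unit x) (stereo_unit y).
have : dot3 (stereo x) (stereo y) = 1.
  by rewrite -[LHS]acosK ?in_itv//= h cos0.
case: (stereo x) (stereo y) => [[a b] c] [[a' b'] c']; rewrite /dot3 /=.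
move=> e1 e2 e3.
have e : (a - a') ^+ 2 + (b - b') ^+ 2 + (c - c') ^+ 2 = 0.
  by transitivity ((a * a + b * b + c * c) + (a' * a' + b' * b' + c' * c')
    - 2 * (a * a' + b * b' + c * c')); [ring|rewrite e1 e2 e3; ring].
have /andP[/andP[/eqP ? /eqP ?] /eqP ?] : (a - a' == 0) && (b - b' == 0)
    && (c - c' == 0).
  move/eqP: e; rewrite paddr_eq0 ?addr_ge0 ?sqr_ge0//.
  by rewrite paddr_eq0 ?sqr_ge0// !sqrf_eq0.
by congr (_, _, _); apply/eqP; rewrite -subr_eq0; apply/eqP.
Qed.

Lemma spherical_dist_triangle y x z :
  spherical_dist x z <= spherical_dist x y + spherical_dist y z.
Proof.
rewrite /spherical_dist.
have ab := dot3_itv (stereo_unit x) (stereo_unit y).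
have bc := dot3_itv (stereo_unit y) (stereo_unit z).
have ac := dot3_itv (stereo_unit x) (stereo_unit z).
have := gram3_ge0 (stereo_unit x) (stereo_unit y) (stereo_unit z).
move: ab bc ac.
set a := dot3 _ _; set b := dot3 _ (stereo z); set c := dot3 _ (stereo z).
move=> ab bc ac gram.
have [pil|pig] := lerP pi (acos a + acos b).
  by apply: le_trans pil; exact: acos_lepi.
rewrite leNgt; apply/negP => lt_ab.
have : cos (acos c) < cos (acos a + acos b).
  by rewrite ltr_cos// in_itv/= ?acos_ge0 ?acos_lepi ?addr_ge0 ?acos_ge0//= ltW.
rewrite cosD !acosK ?in_itv// !sin_acos// -sqrtrM; last first.
  by case/andP: ab => *; nra.
rewrite ltNge => /negP; apply.
rewrite lerBlDl -lerBlDr.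
have [n|p] := lerP (a * b - c) 0; first exact: le_trans n (sqrtr_ge0 _).
rewrite -(ger0_norm (ltW p)) -sqrtr_sqr ler_wsqrtr//.
Qed.

HB.instance Definition _ := @isMetric.Build R (riemann_sphere R)
  (@spherical_dist R) spherical_distxx spherical_dist_eq0 spherical_dist_sym
  spherical_dist_triangle.

End SphericalMetric.

Definition boundary (T : topologicalType) (A : set T) : set T :=
  closure A `\` A°.

Definition is_domain (T : topologicalType) (A : set T) : Prop :=
  open A /\ connected A.

Section MetricNotions.
Context {R : realType} {T : metricType R}.
Local Open Scope ereal_scope.

Definition diam (A : set T) : \bar R :=
  ereal_sup [set (mdist p.1 p.2)%:E | p in A `*` A].

(* This is +oo when A is empty. *)
Definition dist_set (z : T) (A : set T) : \bar R :=
  ereal_inf [set (mdist z w)%:E | w in A].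

End MetricNotions.

(* An arc is given by an injective continuous parametrization g of [0, 1]; the
   sub-arc from g(t) to the tip g(1) is then the image of [t, 1]. *)
Definition john_arc (R : realType) (Omega : set (riemann_sphere R)) (L : R)
    (z0 z1 : riemann_sphere R) (g : R -> riemann_sphere R) : Prop :=
  [/\ {within `[0, 1], continuous g},
      {in `[0, 1] &, injective g},
      g 0 = z0 /\ g 1 = z1,
      g @` `[0, 1] `<=` Omega &
      forall t : R, 0 <= t <= 1 ->
        (diam (g @` `[t, 1%R]) <= L%:E * dist_set (g t) (boundary Omega))%E].

(* The case z = z0 is left out since no arc joins a point to itself. *)
Definition john_domain (R : realType) (L : R)
    (Omega : set (riemann_sphere R)) : Prop :=
  is_domain Omega /\
  exists2 z0, Omega z0 &
    forall z, Omega z -> z <> z0 -> exists g, john_arc Omega L z0 z g.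

(* The maps phi are only constrained on the ball B(p n, r). *)
Definition gromov_hausdorff_cvg (R : realType) (X : nat -> Type)
    (d : forall n, X n -> X n -> R) (p : forall n, X n)
    (Y : Type) (d' : Y -> Y -> R) (q : Y) : Prop :=
  forall eps r : R, 0 < eps -> 1 <= r ->
  \forall n \near \oo, exists phi : X n -> Y,
    [/\ phi (p n) = q,
        forall y, d' q y < r ->
          exists2 x, d n (p n) x < r & d' (phi x) y < eps &
        forall x y, d n (p n) x < r -> d n (p n) y < r ->
          `|d n x y - d' (phi x) (phi y)| < eps].

HB.structure Definition CompleteMetric (R : numDomainType) :=
  {T of Complete T & Metric R T}.
Notation completeMetricType := CompleteMetric.type.

(* The space (X, d) is meant to be a doubling metric space; this is not part of
   the definition since it holds for every subset of the sphere. *)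
Definition weak_tangent (R : realType) (X : Type) (d : X -> X -> R)
    (Y : completeMetricType R) (q : Y) : Prop :=
  exists (p : nat -> X) (lam : nat -> R),
    [/\ forall n, 0 < lam n,
        lam @ \oo --> (0 : R) &
        gromov_hausdorff_cvg (fun n x y => (lam n)^-1 * d x y) p
          (@mdist R Y) q].

Definition components (T : topologicalType) : set (set T) :=
  [set connected_component [set: T] x | x in [set: T]].
Arguments components : clear implicits.

(* Main.v *)
Require Import Defs.
From HB Require Import structures.
From mathcomp Require Import all_boot all_order all_algebra.
From mathcomp Require Import finmap complex ring lra.
From mathcomp Require Import boolp classical_sets cardinality reals ereal.
From mathcomp Require Import topology normedtype trigo prodnormedzmodule derive.

Set Implicit Arguments.
Unset Strict Implicit.
Unset Printing Implicit Defensive.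

Import Order.TTheory GRing.Theory Num.Theory.
Import numFieldNormedType.Exports ProdNormedZmodule.Exports.

Local Open Scope classical_set_scope.
Local Open Scope ring_scope.

(* Points of a weak tangent in different components are approximated by points
   of the boundary that cannot be linked by small steps inside a much larger
   ball B(p, 40Lt). If there are too many of them, three have the following
   data in common, up to a small error: the point where a John arc ending near
   x_i enters B(p, 2t), the point where a John arc ending near a boundary point
   at distance 10Lt linked to x_i enters B(p, 20Lt), and a boundary point at
   distance 30Lt linked to x_i. The John condition keeps the first two points
   away from the boundary, so that there are only boundedly many choices, and
   it makes the second arc avoid B(p, 4t). Joining the three common points to
   the three pieces of the boundary then draws K_{3,3} in the plane. Everything
   is done with finite chains of small steps, so the only planar topology that
   is needed is a parity count of crossings. *)

(** * Parity of crossings *)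

Section K33.
Variable R : realType.
Implicit Types (u v w : R * R) (s : R).

(** The horizontal axis is itself divided, so that [u] and [- u] lie on opposite sides for every
    nonzero [u]. *)
Definition upper u : bool := (0 < u.2) || (u.2 == 0) && (0 < u.1).

(* Whether a short segment from [u] to [v] crosses the positive half-axis. *)
Definition crosses u v : bool := (upper u (+) upper v) && (0 < u.1).

Lemma upperN u : u != 0 -> upper (- u) = ~~ upper u.
Proof.
case: u => a b; rewrite /upper /= oppr_eq0 !oppr_gt0 => nz.
case: (ltgtP b 0) nz => //= ->; case: (ltgtP a 0) => //= ->.
by rewrite eqxx.
Qed.

Lemma normP_le u (e : R) : `|u| <= e <-> `|u.1| <= e /\ `|u.2| <= e.
Proof. by rewrite prod_normE ge_max; split => /andP. Qed.

Lemma upper_neq u v (e : R) : upper u != upper v -> `|u - v| <= e -> `|u.2| <= e.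
Proof.
rewrite /upper => + /normP_le[_ /=]; rewrite !ler_norml => + /andP[] *.
move=> h; apply/andP; move: h.
by case: (ltgtP u.2 0) => hu; case: (ltgtP v.2 0) => hv //= _; split; lra.
Qed.

(** Near the horizontal axis the maximum norm forces the first coordinate to be at least [10 * s] in
    absolute value, so a step of size [2 * s] cannot change its sign. *)
Lemma same_side u v (s : R) : 0 < s -> 10 * s <= `|u| -> 10 * s <= `|v| ->
  `|u - v| <= 2 * s -> `|u.2| <= 4 * s -> (0 < u.1) = (0 < v.1) /\ u.1 != 0.
Proof.
move=> s0 hu hv /normP_le[/= + +] h2.
have u1 : 10 * s <= `|u.1|.
  move: hu; rewrite prod_normE le_max => /orP[//|]; lra.
rewrite !ler_norml => /andP[? ?] /andP[? ?].
have {}h2 : `|v.2| <= 6 * s.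
  by move: h2; rewrite !ler_norml => /andP[? ?]; apply/andP; split; lra.
have v1 : 10 * s <= `|v.1|.
  by move: hv; rewrite prod_normE le_max => /orP[//|]; lra.
move: u1 v1; rewrite !ler_normr => /orP[?|?] /orP[?|?]; split; lra.
Qed.

Lemma subrACA (V : zmodType) (x y z t : V) : x - y - (z - t) = x - z - (y - t).
Proof. by rewrite !opprB addrACA [RHS]addrACA [- y + _]addrC. Qed.

(** If the four corners are on one side, no edge crosses. Otherwise [u00] is near the horizontal
    axis, where [same_side] makes the sign of the first coordinate constant and the bits [upper]
    telescope along both ways round. *)
Lemma crosses_cell (s : R) (u00 u10 u01 u11 : R * R) : 0 < s ->
  10 * s <= `|u00| -> 10 * s <= `|u10| -> 10 * s <= `|u01| -> 10 * s <= `|u11| ->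
  `|u00 - u10| <= s -> `|u00 - u01| <= s -> `|u00 - u11| <= 2 * s ->
  `|u10 - u01| <= 2 * s -> `|u10 - u11| <= s -> `|u01 - u11| <= s ->
  crosses u00 u10 (+) crosses u10 u11 = crosses u00 u01 (+) crosses u01 u11.
Proof.
move=> s0 g00 g10 g01 g11 d1 d2 d3 d4 d5 d6.
have fin : `|u00.2| <= 4 * s -> crosses u00 u10 (+) crosses u10 u11 =
    crosses u00 u01 (+) crosses u01 u11.
  move=> h.
  have [|e1 _] := same_side s0 g00 g10 _ h; first by lra.
  have [|e2 _] := same_side s0 g00 g01 _ h; first by lra.
  rewrite /crosses -e1 -e2.
  by case: (0 < _); rewrite ?andbT ?andbF // -!addbA !addKb.
have e00 (v : R * R) : `|u00 - v| <= 2 * s -> upper u00 != upper v ->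
    `|u00.2| <= 4 * s.
  by move=> dv /upper_neq/(_ dv); lra.
have [eq1|/e00 h] := eqVneq (upper u00) (upper u10); last by apply/fin/h; lra.
have [eq2|/e00 h] := eqVneq (upper u00) (upper u01); last by apply/fin/h; lra.
have [eq3|/e00 h] := eqVneq (upper u00) (upper u11); last by apply/fin/h; lra.
by rewrite /crosses -eq1 -eq2 -eq3 !addbb.
Qed.

(** The negated points test the negative half-axis, and a short step that changes sides crosses
    exactly one of the two half-axes. *)
Lemma crossesN (s : R) u v : 0 < s -> 10 * s <= `|u| -> 10 * s <= `|v| ->
  `|u - v| <= s ->
  crosses u v = crosses (- u) (- v) (+) (upper u (+) upper v).
Proof.
move=> s0 hu hv d.
have u0 : u != 0 by rewrite -normr_gt0; lra.
have v0 : v != 0 by rewrite -normr_gt0; lra.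
rewrite /crosses !upperN//= oppr_gt0.
have [eq|/upper_neq/(_ d) h] := eqVneq (upper u) (upper v).
  by rewrite eq !addbb.
have [||_] := same_side s0 hu hv; [lra|lra|].
by case: (ltgtP u.1 0); case: upper; case: upper.
Qed.

(** The parity with which the chain meets the rightward horizontal ray issued from [u]. *)
Definition crossings (c : nat -> R * R) (n : nat) u : bool :=
  \big[addb/false]_(i < n) crosses (c i - u) (c i.+1 - u).

(* Adds up [crosses_cell] over the grid of all pairs (c i, c' j): the total
   number of crossings along the boundary of the grid is even. *)
Lemma crossings_pair (s : R) (c c' : nat -> R * R) (n n' : nat) : 0 < s ->
  (forall i, (i < n)%N -> `|c i - c i.+1| <= s) ->
  (forall i, (i < n')%N -> `|c' i - c' i.+1| <= s) ->
  (forall i j, (i <= n)%N -> (j <= n')%N -> 10 * s <= `|c i - c' j|) ->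
  crossings c n (c' 0) (+) crossings c n (c' n') (+)
    (crossings c' n' (c 0) (+) crossings c' n' (c n)) =
  upper (c 0 - c' 0) (+) upper (c 0 - c' n') (+)
    (upper (c n - c' 0) (+) upper (c n - c' n')).
Proof.
move=> s0 hc hc' hs.
pose V i k := \big[addb/false]_(j < k) crosses (c i - c' j) (c i - c' j.+1).
(* Seen from [c i], the chain [c'] enters [V] with the opposite sign. [crossesN] restores the sign
   at the cost of side changes, which telescope. *)
have VE i k : (i <= n)%N -> (k <= n')%N ->
    V i k = crossings c' k (c i) (+) (upper (c i - c' 0) (+) upper (c i - c' k)).
  move=> ni; elim: k => [|k IH] kn'.
    by rewrite /V /crossings !big_ord0 addbb.
  rewrite /V /crossings !big_ord_recr /= -/(V i k) IH; last exact: ltnW.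
  rewrite (@crossesN s) ?hs// ?(ltnW kn')//; last first.
    by rewrite subrACA subrr sub0r normrN hc'.
  rewrite !opprB -/(crossings c' k (c i)).
  move: (crossings _ _ _) (crosses _ _) (upper _) (upper _) (upper _).
  by do 5!case.
(* One strip of cells, with [i] fixed; [tot] then stacks the strips. *)
have cell i k : (i < n)%N -> (k <= n')%N ->
    crosses (c i - c' 0) (c i.+1 - c' 0) (+) V i.+1 k =
    V i k (+) crosses (c i - c' k) (c i.+1 - c' k).
  move=> ni; elim: k => [|k IH] kn'.
    by rewrite /V !big_ord0 addbC.
  rewrite /V !big_ord_recr /= -/(V i k) -/(V i.+1 k) addbA IH; last exact: ltnW.
  rewrite -!addbA; congr (_ (+) _).
  have e1 := hc i ni; have e2 := hc' k kn'.
  have ni' := ltnW ni; have kn'' := ltnW kn'.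
  have e3 (a b a' b' : R * R) : `|a - a'| <= s -> `|b - b'| <= s ->
      `|a - b - (a' - b')| <= 2 * s.
    move=> h h'; rewrite subrACA (le_trans (ler_normB _ _))//.
    by rewrite (_ : 2 * s = s + s) ?lerD//; ring.
  apply: (crosses_cell s0).
  - exact: hs.
  - exact: hs.
  - exact: hs.
  - exact: hs.
  - by rewrite subrACA subrr subr0.
  - by rewrite subrACA subrr sub0r normrN.
  - exact: e3.
  - by apply: e3 => //; rewrite distrC.
  - by rewrite subrACA subrr sub0r normrN.
  - by rewrite subrACA subrr subr0.
have tot k m : (m <= n)%N -> (k <= n')%N ->
    crossings c m (c' 0) (+) V m k = V 0%N k (+) crossings c m (c' k).
  move=> + kn'; elim: m => [|m IH] mn.
    by rewrite /crossings !big_ord0 addbC.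
  rewrite /crossings !big_ord_recr /= -addbA cell// addbA.
  by rewrite -/(crossings c m (c' 0)) IH 1?ltnW// -addbA.
move: (tot n' n (leqnn _) (leqnn _)); rewrite !VE//.
move: (crossings c n (c' 0)) (crossings c n (c' n')) (crossings c' n' (c 0)).
move: (crossings c' n' (c n)) (upper (c 0 - c' 0)) (upper (c 0 - c' n')).
move: (upper (c n - c' 0)) (upper (c n - c' n')).
by do 8!case.
Qed.

End K33.

(** * Chains and the graph K33 *)

Section Chain.
Variable R : realType.

Definition chain (T : Type) (d : T -> T -> R) (A : set T) (s : R) (x y : T) :=
  exists n (c : nat -> T), [/\ c 0%N = x, c n = y,
    forall i, (i <= n)%N -> A (c i) &
    forall i, (i < n)%N -> d (c i) (c i.+1) <= s].

Section ChainTheory.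
Variables (T : Type) (d : T -> T -> R).
Implicit Types (A B : set T) (s : R) (x y z : T).

Lemma chain_refl A s x : A x -> chain d A s x x.
Proof. by move=> Ax; exists 0%N, (fun=> x). Qed.

Lemma chain_step A s x y : A x -> A y -> d x y <= s -> chain d A s x y.
Proof.
move=> Ax Ay xy; exists 1%N, (fun i => if i is 0%N then x else y).
by split=> // [[|i]|[|i]].
Qed.

Lemma chain_trans A s y x z :
  chain d A s x y -> chain d A s y z -> chain d A s x z.
Proof.
move=> [m [c [c0 cm Ac dc]]] [n [e [e0 en Ae de]]].
exists (m + n)%N, (fun i => if (i <= m)%N then c i else e (i - m)%N).
split=> [//||i mn|i mn].
- case: ifP => [|_]; last by rewrite addKn.
  rewrite -{2}[m]addn0 leq_add2l leqn0 => /eqP n0.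
  by rewrite n0 addn0 cm -en n0 e0.
- by case: ifP => [/Ac//|_]; apply: Ae; rewrite leq_subLR.
- case: (ltngtP i m) => im.
  + exact: dc.
  + by rewrite subSn 1?ltnW//; apply: de; rewrite ltn_subLR// ltnW.
  + rewrite im subSn// subnn cm -e0; apply: de.
    by move: mn; rewrite im -{1}[m]addn0 ltn_add2l.
Qed.

Lemma chain_sym A s x y : (forall x y, d x y = d y x) ->
  chain d A s x y -> chain d A s y x.
Proof.
move=> dC [n [c [c0 cn Ac dc]]].
exists n, (fun i => c (n - i)%N); split; rewrite ?subn0 ?subnn//.
  by move=> i _; apply: Ac; exact: leq_subr.
move=> i ni; rewrite dC -(subnSK ni); apply: dc.
by rewrite ltn_subrL (leq_trans _ ni).
Qed.

Lemma chain_in A s x y : chain d A s x y -> A x /\ A y.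
Proof.
by move=> [n [c [<- <- Ac _]]]; split; apply: Ac.
Qed.

Lemma chain_ind A s x y (P : set T) : P x ->
  (forall a b, A a -> A b -> chain d A s x a -> P a -> d a b <= s -> P b) ->
  chain d A s x y -> P y.
Proof.
move=> Px IH [n [c [c0 cn Ac dc]]]; rewrite -cn.
suff: forall i, (i <= n)%N -> P (c i) by apply.
elim=> [|i Pi] ni; first by rewrite c0.
apply: (IH (c i)); [exact/Ac/ltnW|exact: Ac| |exact/Pi/ltnW|exact: dc].
exists i, c; split=> // j ji; first by apply/Ac/(leq_trans ji)/ltnW.
exact/dc/(leq_trans ji)/ltnW.
Qed.

Lemma chain_sub A B s s' x y : A `<=` B -> s <= s' ->
  chain d A s x y -> chain d B s' x y.
Proof.
move=> AB ss [n [c [c0 cn Ac dc]]]; exists n, c; split=> // i ni.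
  exact/AB/Ac.
exact: le_trans (dc _ ni) ss.
Qed.

(** Each point of a chain is reached by an initial segment of it. This is how an arm will stay
    inside its piece. *)
Lemma chain_reach A s x y : chain d A s x y ->
  chain d [set z | chain d A s x z] s x y.
Proof.
move=> xy; have [Ax _] := chain_in xy.
apply: (chain_ind _ _ xy); first exact/chain_refl/chain_refl.
move=> a b Aa Ab xa IH ab; apply: (chain_trans IH).
by apply: chain_step => //=; apply: (chain_trans xa); exact: chain_step.
Qed.

Lemma chain_exit (f : T -> R) (rho : R) A s x y : 0 < s ->
  (forall a b, f b <= f a + d a b) -> f x < rho -> rho <= f y ->
  chain d A s x y ->
  exists2 z, rho <= f z <= rho + s &
    chain d (A `&` [set a | f a <= rho + s]) s x z.
Proof.
move=> s0 fd fx fy xy; have [Ax _] := chain_in xy; apply: contrapT => noz.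
suff: f y < rho /\ chain d (A `&` [set a | f a <= rho + s]) s x y.
  by rewrite ltNge fy; case.
apply: (chain_ind (P := fun y => f y < rho /\
  chain d (A `&` [set a | f a <= rho + s]) s x y) _ _ xy).
  by split=> //; apply: chain_refl; split => //=; lra.
move=> a b Aa Ab _ [fa xa] ab.
have fab := fd a b.
have ar : chain d (A `&` [set a | f a <= rho + s]) s x b.
  apply: (chain_trans xa); apply: chain_step => //; split => //=; lra.
split=> //; rewrite ltNge; apply/negP => fb; apply: noz; exists b => //.
by rewrite fb/=; lra.
Qed.

End ChainTheory.

Lemma chain_map (T T' : Type) d d' (f : T -> T') (A : set T) (B : set T')
    (s s' : R) x y :
  (forall a, A a -> B (f a)) ->
  (forall a b, A a -> A b -> d a b <= s -> d' (f a) (f b) <= s') ->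
  chain d A s x y -> chain d' B s' (f x) (f y).
Proof.
move=> AB dd [n [c [<- <- Ac dc]]]; exists n, (f \o c).
split=> // i ni /=; first exact/AB/Ac.
by apply: dd; [exact/Ac/ltnW|exact: Ac|exact: dc].
Qed.

Definition plane_dist (u v : R * R) : R := `|u - v|.

Lemma plane_chain_ball (s h : R) (u v : R * R) : 0 < s -> `|u - v| <= h ->
  chain plane_dist [set w | `|w - u| <= h] s u v.
Proof.
move=> s0 uvh.
pose n := (Num.bound (h / s)).+1.
have n0 : (0 : R) < n%:R by rewrite ltr0n.
have h0 : 0 <= h by apply: le_trans uvh.
have hsn : h / s <= n%:R.
  have := archi_boundP (divr_ge0 h0 (ltW s0)).
  by rewrite /n -natr1 => ?; lra.
have hn : `|u - v| / n%:R <= s.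
  by rewrite ler_pdivrMr// mulrC -ler_pdivrMr// (le_trans _ hsn)// ler_pM2r ?invr_gt0.
pose c i : R * R := (u.1 + i%:R / n%:R * (v.1 - u.1), u.2 + i%:R / n%:R * (v.2 - u.2)).
have normM (a : R) (b : R * R) : `|(a * b.1, a * b.2) : R * R| = `|a| * `|b|.
  by rewrite !prod_normE /= !normrM maxr_pMr.
have normc i j : `|c i - c j| = `|i%:R / n%:R - j%:R / n%:R| * `|u - v|.
  rewrite -[in RHS]normrN -normM; congr (`| _ |).
  by rewrite /c; congr (_, _) => /=; ring.
exists n, c; split.
- by rewrite /c /= !mul0r !addr0 -surjective_pairing.
- by rewrite /c divff ?gt_eqF// !mul1r !subrKC -surjective_pairing.
- move=> i ni /=; have -> : u = c 0%N.
    by rewrite /c !mul0r !addr0 -surjective_pairing.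
  rewrite normc !mul0r subr0 ger0_norm ?divr_ge0// (le_trans _ uvh)//.
  by rewrite ler_piMl// ler_pdivrMr// mul1r ler_nat.
- move=> i ni; rewrite /plane_dist normc -mulrBl -natr1 opprD addrA subrr sub0r.
  by rewrite mulN1r normrN ger0_norm ?invr_ge0// mulrC.
Qed.

End Chain.

Section ConnectedChain.
Variables (R : realType) (T : metricType R).

(** The points of [A] reachable from [x] form a nonempty subset that is both open and closed in
    [A]. *)
Lemma connected_chain (A : set T) (s : R) x y : connected A -> 0 < s ->
  A x -> A y -> chain mdist A s x y.
Proof.
move=> cA s0 Ax Ay.
pose B := [set z | A z /\ chain mdist A s x z].
suff BA : B = A by have [] : B y by rewrite BA.
have near_B w z : A w -> A z -> (ball w s)° z ->
    chain mdist A s x w <-> chain mdist A s x z.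
  move=> Aw Az /interior_subset; rewrite ballEmdist /= => /ltW wz.
  by split=> xw; apply: (chain_trans xw); apply: chain_step => //;
    rewrite metric_sym.
apply: cA.
- by exists x; split=> //; exact: chain_refl.
- exists (\bigcup_(z in B) (ball z s)°).
    by apply: bigcup_open => z _; exact: open_interior.
  apply/seteqP; split=> [z [Az Bz]|z [Az [w [Aw xw]]]].
    by split=> //; exists z => //; exact: nbhsx_ballx.
  by move=> wz; split=> //; apply/(near_B w).
- exists (~` \bigcup_(z in A `\` B) (ball z s)°).
    by apply: open_closedC; apply: bigcup_open => z _; exact: open_interior.
  apply/seteqP; split=> [z [Az Bz]|z [Az nz]].
    split=> // -[w [Aw Bw]] wz; apply: Bw; split=> //.
    exact/(near_B _ z).
  apply: contrapT => Bz; apply: nz; exists z; first by split.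
  exact: nbhsx_ballx.
Qed.

End ConnectedChain.

Section NoK33.
Variable R : realType.

(** Addition of booleans is exclusive or. In the sum of the hypothesis over the six ordered pairs,
    [X], [X'], [P], [Q], [Q'] and the constant 1 cancel, while each of the three unordered pairs
    leaves [S j l + S l j = 1]. *)
Lemma crossing_parity_pair (P : bool) (X X' Q Q' : nat -> bool)
    (Y Y' S : nat -> nat -> bool) :
  let Z (Y : nat -> nat -> bool) :=
    Y 0%N 1%N + Y 0%N 2 + Y 1%N 0%N + Y 1%N 2 + Y 2 0%N + Y 2 1%N in
  (forall j l, (j < 3)%N -> (l < 3)%N -> j != l ->
    X j + Y j l + (X' l + Y' l j) = P + Q l + (1 + Q' j + S j l)) ->
  (forall j l, (j < 3)%N -> (l < 3)%N -> j != l -> S l j = 1 + S j l) ->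
  Z Y + Z Y' = 1.
Proof.
move=> Z H HS.
have dbl (b : bool) : b + b = 0 by case: b.
(* [D] and [D'] hold one copy of each doubled term. Adding them twice changes nothing modulo 2 and
   turns both equations into identities of commutative rings. *)
pose D := X 0%N + X 1%N + X 2 + X' 0%N + X' 1%N + X' 2.
pose D' := P + P + P + Q 0%N + Q 1%N + Q 2 + Q' 0%N + Q' 1%N + Q' 2
  + 1 + 1 + 1 + S 0%N 1%N + S 0%N 2 + S 1%N 2 + 1.
transitivity (Z Y + Z Y' + (D + D)); first by rewrite dbl addr0.
transitivity (1 + (D' + D')); last by rewrite dbl addr0.
transitivity (P + Q 1%N + (1 + Q' 0%N + S 0%N 1%N) +
  (P + Q 2 + (1 + Q' 0%N + S 0%N 2)) + (P + Q 0%N + (1 + Q' 1%N + S 1%N 0%N)) +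
  (P + Q 2 + (1 + Q' 1%N + S 1%N 2)) + (P + Q 0%N + (1 + Q' 2 + S 2 0%N)) +
  (P + Q 1%N + (1 + Q' 2 + S 2 1%N))).
  by rewrite -!H// /Z /D; ring.
rewrite (HS 0%N 1%N)// (HS 0%N 2)// (HS 1%N 2)// /D'; ring.
Qed.

(* [a] and [b] are the two colour classes and [E i j] carries the edge from
   [a i] to [b j]. When [crossings_pair] is summed over the pairs of independent
   edges, each term cancels modulo 2 except
   [upper (b j - b l) + upper (b l - b j) = 1], which occurs nine times. *)
Lemma no_K33 (s : R) (a b : nat -> R * R) (E : nat -> nat -> set (R * R)) :
  0 < s ->
  (forall i j, (i < 3)%N -> (j < 3)%N ->
    chain (@plane_dist R) (E i j) s (a i) (b j)) ->
  (forall i k j l u v, (i < 3)%N -> (k < 3)%N -> (j < 3)%N -> (l < 3)%N ->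
    (i < k)%N -> j != l -> E i j u -> E k l v -> 10 * s <= `|u - v|) ->
  False.
Proof.
move=> s0 hE hsep.
(* Indices outside the nine edges get an arbitrary chain, so that all edges can be chosen at
   once. *)
have hc (ij : nat * nat) : exists c : nat * (nat -> R * R),
    (ij.1 < 3)%N -> (ij.2 < 3)%N ->
    [/\ c.2 0%N = a ij.1, c.2 c.1 = b ij.2,
      forall k, (k <= c.1)%N -> E ij.1 ij.2 (c.2 k) &
      forall k, (k < c.1)%N -> `|c.2 k - c.2 k.+1| <= s].
  case: ij => i j /=.
  have [i3|] := boolP (i < 3)%N; last by exists (0%N, fun=> 0).
  have [j3|] := boolP (j < 3)%N; last by exists (0%N, fun=> 0).
  by have [n [c hc]] := hE i j i3 j3; exists (n, c).
have {hc} [F hF] := choice hc.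
pose X i j u := crossings (F (i, j)).2 (F (i, j)).1 u.
have vertex_neq i j : (i < 3)%N -> (j < 3)%N -> i != j ->
    upper (b j - b i) = 1 + upper (b i - b j).
  move=> i3 j3 ij; rewrite -opprB upperN//.
  suff : 10 * s <= `|b i - b j| by move=> ?; rewrite -normr_gt0; lra.
  apply: (hsep 0%N 1%N i j) => //.
    by have [_ /= <- + _] := hF (0%N, i) isT i3; exact.
  by have [_ /= <- + _] := hF (1%N, j) isT j3; exact.
have key i k : (i < k)%N -> (k < 3)%N -> forall j l, (j < 3)%N -> (l < 3)%N ->
    j != l ->
    X i j (a k) + X i j (b l) + (X k l (a i) + X k l (b j)) =
    upper (a i - a k) + upper (a i - b l) +
      (1 + upper (a k - b j) + upper (b j - b l)).
  move=> ik k3 j l j3 l3 jl; have i3 := ltn_trans ik k3.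
  have [e1 e2 Ec dc] := hF (i, j) i3 j3; have [e1' e2' Ec' dc'] := hF (k, l) k3 l3.
  rewrite /= in e1 e2 Ec dc e1' e2' Ec' dc'.
  have sep i' j' : (i' <= (F (i, j)).1)%N -> (j' <= (F (k, l)).1)%N ->
      10 * s <= `|(F (i, j)).2 i' - (F (k, l)).2 j'|.
    by move=> hi hj; apply: (hsep i k j l) => //; [exact: Ec|exact: Ec'].
  have := crossings_pair s0 dc dc' sep; rewrite e1 e2 e1' e2' => H.
  apply: (etrans H); congr (_ (+) _ (+) (_ (+) _)); rewrite -opprB upperN//.
  suff : 10 * s <= `|a k - b j| by move=> ?; rewrite -normr_gt0; lra.
  rewrite distrC; apply: (hsep i k j l) => //.
    by rewrite -e2; exact: Ec.
  by rewrite -e1'; exact: Ec'.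
pose Y i j l := X i j (b l).
(* [Z i] involves only the edges at [a i]. The three booleans [Z 0], [Z 1], [Z 2] would have to be
   pairwise different. *)
pose Z i : bool := Y i 0%N 1%N + Y i 0%N 2 + Y i 1%N 0%N + Y i 1%N 2
  + Y i 2 0%N + Y i 2 1%N.
have par i k : (i < k)%N -> (k < 3)%N -> Z i + Z k = 1.
  by move=> ik k3; exact: crossing_parity_pair (key i k ik k3) vertex_neq.
have := par 0%N 1%N isT isT; have := par 0%N 2%N isT isT.
have := par 1%N 2%N isT isT.
by move: (Z 0%N) (Z 1%N) (Z 2%N) => [] [] [].
Qed.

End NoK33.

(** * Charts of the sphere *)

Section Chart.
Variable R : realType.
Implicit Types (t : R).

Lemma sin_MVT t : 0 < t -> exists2 c, 0 < c < t & sin t = cos c * t.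
Proof.
move=> t0.
have [|c] := @MVT R (@sin R) (@cos R) 0 t t0 (fun x _ => is_derive_sin x).
  by apply: continuous_subspaceT; exact: continuous_sin.
by rewrite in_itv/= sin0 !subr0 => ? ?; exists c.
Qed.

(** Both quadratic bounds come from [cos t = 1 - 2 * sin (t / 2) ^+ 2], with the sine estimated by
    the mean value theorem. *)
Lemma cos_ge_quadratic t : 0 <= t -> 1 - t ^+ 2 / 2 <= cos t.
Proof.
rewrite le_eqVlt => /predU1P[<-|t0]; first by rewrite cos0; lra.
have [|c _ e] := @sin_MVT (t / 2); first by lra.
have -> : t = (t / 2) *+ 2 by rewrite -mulr_natr; lra.
rewrite cos_mulr2n cos2sin2 e exprMn cos2sin2 -mulr_natr.
have := sqr_ge0 (sin c); nra.
Qed.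

Lemma cos_le_quadratic t : 0 <= t <= 1 -> cos t <= 1 - t ^+ 2 / 4.
Proof.
rewrite le_eqVlt => /andP[/predU1P[<- _|t0 t1]]; first by rewrite cos0; lra.
have [|c /andP[c0 ct] e] := @sin_MVT (t / 2); first by lra.
have hc := cos_ge_quadratic (ltW c0).
have -> : t = (t / 2) *+ 2 by rewrite -mulr_natr; lra.
rewrite cos_mulr2n cos2sin2 e exprMn -mulr_natr.
have hc' : 7 / 8 <= cos c by nra.
have : 49 / 64 <= cos c ^+ 2 by nra.
have := sqr_ge0 (t / 2); nra.
Qed.

(** [e] and [f] are the images of the first two basis vectors under the rotation that carries
    [(0, 0, k)] to [v]. The sign [k] is that of [c], which keeps the denominator [1 + k * c] at
    least 1. *)
Lemma orthonormal_frame (v : R * R * R) : dot3 v v = 1 ->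
  exists e f, forall u, dot3 u e ^+ 2 + dot3 u f ^+ 2 + dot3 u v ^+ 2 = dot3 u u.
Proof.
case: v => [[a b] c]; rewrite /dot3 /= => v1.
have [k [k1 kc]] : exists k : R, k ^+ 2 = 1 /\ 1 + k * c != 0.
  have [c0|c0] := lerP 0 c; [exists 1|exists (-1)]; split; try ring;
  by rewrite gt_eqF//; lra.
pose m := (1 + k * c)^-1.
have em : m * (1 + k * c) = 1 by rewrite mulVf.
exists (1 - a ^+ 2 * m, - a * b * m, - k * a), (- a * b * m, 1 - b ^+ 2 * m, - k * b).
move=> [[x y] z] /=.
pose q := a * x + b * y; pose r := a ^+ 2 + b ^+ 2; pose w := q * m + k * z.
have c2 : c ^+ 2 = 1 - r by rewrite -v1 /r; ring.
have rm : r * m = 1 - k * c.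
  have -> : r = (1 - k * c) * (1 + k * c).
    transitivity (1 - k ^+ 2 * c ^+ 2); last ring.
    by rewrite k1 c2; ring.
  by rewrite -mulrA [X in _ * X]mulrC em mulr1.
have rw : r * w = (1 - k * c) * q + r * k * z by rewrite -rm /w; ring.
have wk : w * (1 + k * c) = q + k * z * (1 + k * c).
  by rewrite -[in RHS](mul1r q) -[X in X * q]em /w; ring.
transitivity (x ^+ 2 + y ^+ 2 - 2 * q * w + w * (r * w) + (q + c * z) ^+ 2).
  by rewrite /w /r /q; ring.
transitivity (x ^+ 2 + y ^+ 2 - (w * (1 + k * c)) * q + (r * w) * (k * z)
    + (q + c * z) ^+ 2).
  by rewrite {1}rw; ring.
rewrite wk rw.
transitivity (x ^+ 2 + y ^+ 2 + (k ^+ 2 * r + c ^+ 2) * z ^+ 2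
  + 2 * c * (1 - k ^+ 2) * q * z); first ring.
by rewrite k1 c2; ring.
Qed.

Lemma dot3B (u v w : R * R * R) : dot3 (u - v) w = dot3 u w - dot3 v w.
Proof. by case: u v w => [[? ?] ?] [[? ?] ?] [[? ?] ?]; rewrite /dot3/=; ring. Qed.

(** The chart is the orthogonal projection to the tangent plane at [p]. It contracts because a chord
    is shorter than its arc. Conversely, near [p] the normal components are close to 1, and the
    equation of the sphere bounds their difference by the tangential one. *)
Lemma sphere_chart (p : riemann_sphere R) : exists phi : riemann_sphere R -> R * R,
  phi p = 0 /\
  forall x y, mdist p x <= 1 / 4 -> mdist p y <= 1 / 4 ->
    `|phi x - phi y| <= mdist x y /\ mdist x y <= 3 * `|phi x - phi y|.
Proof.
have [e [f ef]] := orthonormal_frame (stereo_unit p).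
set v := stereo p in ef *.
exists (fun x => (dot3 (stereo x) e, dot3 (stereo x) f)); split.
  have := ef v; rewrite [dot3 v v]stereo_unit expr1n => h.
  have he := sqr_ge0 (dot3 v e); have hf := sqr_ge0 (dot3 v f).
  have e0 : dot3 v e ^+ 2 = 0 by lra.
  have f0 : dot3 v f ^+ 2 = 0 by lra.
  by move/eqP: e0; move/eqP: f0; rewrite !sqrf_eq0 => /eqP -> /eqP ->.
have cosd x y : cos (mdist x y) = dot3 (stereo x) (stereo y).
  by rewrite acosK// in_itv/= dot3_itv ?stereo_unit.
have hx x : mdist p x <= 1 / 4 -> 31 / 32 <= dot3 (stereo x) v <= 1.
  move=> px; rewrite dot3C -cosd cos_le1 andbT.
  by have := cos_ge_quadratic (mdist_ge0 p x); have := mdist_ge0 p x; nra.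
move=> x y px py.
have xy1 : mdist x y <= 1 / 2.
  have := metric_triangle x p y; rewrite [mdist x p]metric_sym; lra.
have := hx _ px; have := hx _ py.
have := ef (stereo x - stereo y); have := ef (stereo x); have := ef (stereo y).
rewrite !dot3B !stereo_unit.
have -> : dot3 (stereo x) (stereo x - stereo y) = 1 - cos (mdist x y).
  by rewrite dot3C dot3B stereo_unit cosd dot3C.
have -> : dot3 (stereo y) (stereo x - stereo y) = cos (mdist x y) - 1.
  by rewrite dot3C dot3B stereo_unit cosd.
have := cos_ge_quadratic (mdist_ge0 x y).
have := @cos_le_quadratic (mdist x y); rewrite mdist_ge0 => /(_ _).
have := mdist_ge0 x y.
rewrite prod_normE /=.
move: (mdist x y) xy1 (cos (mdist x y)) => d d1 c.
move: (dot3 _ e) (dot3 _ e) (dot3 _ f) (dot3 _ f) (dot3 _ v) (dot3 _ v).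
move=> X1 Y1 X2 Y2 a b d0 c1 c2 y1 x1 xy /andP[b0 b1] /andP[a0 a1].
have {}c1 : c <= 1 - d ^+ 2 / 4 by apply: c1; lra.
split.
  rewrite ge_max !ler_norml.
  have := sqr_ge0 (X1 - Y1); have := sqr_ge0 (X2 - Y2); have := sqr_ge0 (a - b).
  by move=> *; apply/andP; split; apply/andP; split; nra.
set m := Num.max _ _.
have m1 : `|X1 - Y1| <= m by rewrite le_max lexx.
have m2 : `|X2 - Y2| <= m by rewrite le_max lexx orbT.
pose U := X1 - Y1; pose V := X2 - Y2; pose P := X1 + Y1; pose Q := X2 + Y2.
(* Both points have norm 1, so the difference of the squared normal components is minus that of the
   squared tangential ones; [a + b] is close to 2. *)
have ab : (a - b) * (a + b) = - (U * P + V * Q).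
  transitivity (a ^+ 2 - b ^+ 2); first ring.
  transitivity (Y1 ^+ 2 + Y2 ^+ 2 - (X1 ^+ 2 + X2 ^+ 2)); first lra.
  by rewrite /U /V /P /Q; ring.
have CS : (U * P + V * Q) ^+ 2 <= (U ^+ 2 + V ^+ 2) * (P ^+ 2 + Q ^+ 2).
  by have := sqr_ge0 (U * Q - V * P); nra.
have PQ : P ^+ 2 + Q ^+ 2 <= 1 / 4.
  have := sqr_ge0 (X1 - Y1); have := sqr_ge0 (X2 - Y2).
  by rewrite /P /Q; nra.
have S0 : 0 <= U ^+ 2 + V ^+ 2 by rewrite addr_ge0 ?sqr_ge0.
have ab2 : (a - b) ^+ 2 * 3 <= (U ^+ 2 + V ^+ 2) / 4.
  have : (a - b) ^+ 2 * (a + b) ^+ 2 <= (U ^+ 2 + V ^+ 2) / 4.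
    rewrite -exprMn ab sqrrN; nra.
  have : 3 <= (a + b) ^+ 2 by nra.
  by have := sqr_ge0 (a - b); nra.
have Um : U ^+ 2 <= m ^+ 2 by move: m1; rewrite -/U ler_norml => /andP[*]; nra.
have Vm : V ^+ 2 <= m ^+ 2 by move: m2; rewrite -/V ler_norml => /andP[*]; nra.
have m0 : 0 <= m := le_trans (normr_ge0 _) m1.
have : d ^+ 2 <= 9 * m ^+ 2 by rewrite -/U -/V in xy; lra.
nra.
Qed.

End Chart.

(** * Grid classes, pigeonhole and finite minima *)

Section Finite.
Variable R : realType.

(** Points are labelled by their grid square of side [h]. The number of labels depends on [M] alone,
    which is why the final bound depends on [L] alone. *)
Lemma grid_classes (h : R) (M : nat) : 0 < h ->
  exists f : R * R -> 'I_(2 * M).+1 * 'I_(2 * M).+1, forall u v,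
    `|u| <= M%:R * h -> `|v| <= M%:R * h -> f u = f v -> `|u - v| <= h.
Proof.
move=> h0.
(* The shift by [M] makes the quotient nonnegative. The right end of the interval takes the value
   [2 * M], hence [(2 * M).+1] labels per coordinate. *)
pose n (x : R) := Num.truncn (x / h + M%:R).
have nP x : `|x| <= M%:R * h -> (n x < (2 * M).+1)%N /\
    (n x)%:R * h <= x + M%:R * h < (n x)%:R * h + h.
  rewrite ler_norml => /andP[x1 x2].
  have x3 : 0 <= x / h + M%:R by rewrite -lerBlDr sub0r ler_pdivlMr// mulNr.
  have := truncn_itv x3; rewrite -/(n x) => /andP[n1 n2].
  have xh : (x / h + M%:R) * h = x + M%:R * h by rewrite mulrDl divfK ?gt_eqF.
  split; last first.
    rewrite -xh; apply/andP; split; first by rewrite ler_pM2r.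
    by rewrite -[X in _ < _ + X]mul1r -mulrDl ltr_pM2r// natr1.
  rewrite ltnS -(ler_nat R) natrM (le_trans n1)//.
  have : x / h <= M%:R by rewrite ler_pdivrMr.
  lra.
exists (fun u => (inord (n u.1), inord (n u.2))) => u v.
rewrite !prod_normE !ge_max => /andP[u1 u2] /andP[v1 v2] [].
have [lu1 bu1] := nP _ u1; have [lu2 bu2] := nP _ u2.
have [lv1 bv1] := nP _ v1; have [lv2 bv2] := nP _ v2.
move=> /(congr1 val) /=; rewrite !inordK// => e1.
move=> /(congr1 val) /=; rewrite !inordK// => e2.
move: bu1 bu2 bv1 bv2; rewrite e1 e2.
by move=> *; apply/andP; split; rewrite ler_norml; lra.
Qed.

Lemma pigeonhole3 (I G : finType) (f : I -> G) : (2 * #|G| < #|I|)%N ->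
  exists x y z, [/\ x != y, y != z, z != x, f x = f y & f y = f z].
Proof.
move=> card; apply: contrapT => H; move: card; apply/negP; rewrite -leqNgt.
rewrite -sum1_card (partition_big f xpredT)//= mulnC -sum_nat_const leq_sum// => g _.
rewrite sum1_card leqNgt; apply/negP => /card_gt2P[x [y [z [[fx fy fz] [xy yz zx]]]]].
apply: H; exists x, y, z; split=> //.
  by move: fx fy; rewrite !unfold_in => /eqP -> /eqP ->.
by move: fz fy; rewrite !unfold_in => /eqP -> /eqP ->.
Qed.

Lemma finite_common_pos (G : finType) (P : G -> R -> Prop) :
  (forall g, exists2 e, 0 < e & P g e) ->
  (forall g e e', e' <= e -> P g e -> P g e') ->
  exists2 e, 0 < e & forall g, P g e.
Proof.
move=> H mono.
have [E hE] := choice (fun g => let: ex_intro2 e e0 Pe := H g in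
  ex_intro (fun e => 0 < e /\ P g e) e (conj e0 Pe)).
exists (\big[Num.min/1]_g E g).
  by apply/bigmin_gtP; split=> // g _; have [] := hE g.
by move=> g; apply: (mono g (E g)); [exact: bigmin_le|have [] := hE g].
Qed.

End Finite.

Lemma mdist_continuous (R : realType) (T : metricType R) (p : T) :
  continuous (mdist p : T -> R).
Proof.
move=> z; apply/cvgrPdist_lt => e e0; apply/nbhs_ballP; exists e => //= w.
rewrite ballEmdist /= => zw.
have := metric_triangle p z w; have := metric_triangle p w z.
by rewrite [mdist w z]metric_sym ltr_norml; lra.
Qed.

(** * John arcs *)

Section JohnTail.
Variable R : realType.
Let T := riemann_sphere R.
Implicit Types (p z w : T) (Omega : set T).

(** Compactness gives the largest parameter where [f] is at least [rho]. If [f] exceeded [rho]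
    afterwards, the intermediate value theorem would give a later parameter with value [rho]. *)
Lemma last_level (f : R -> R) (rho : R) : {within `[0, 1], continuous f} ->
  f 1 < rho -> rho <= f 0 ->
  exists2 t, 0 <= t <= 1 & f t = rho /\ forall u, t <= u <= 1 -> f u <= rho.
Proof.
move=> fc f1 f0.
pose S := [set t | rho <= f t] `&` `[0, 1].
have cS : compact S.
  have /closed_subspaceP[V cV VS] :
      closed ([set t | rho <= f t] : set (subspace `[0, 1])).
    by move/continuous_closedP : fc => /(_ [set x | rho <= x]); apply; exact: closed_ge.
  by rewrite /S -VS setIC; apply: compact_closedI => //; exact: segment_compact.
have S0 : S !=set0.
  by exists 0; split => //; rewrite /= in_itv/= lexx ler01.
have [t] := compact_EVT_max S0 cS (@continuous_subspaceT _ _ S id (fun x => cvg_id)).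
rewrite inE => -[/= ft]; rewrite in_itv /= => /andP[t0 t1] tmax.
have late u : t <= u <= 1 -> rho <= f u -> u = t.
  move=> /andP[tu u1] fu; apply/eqP; rewrite eq_le tu andbT.
  by apply: tmax; rewrite inE; split => //; rewrite /= in_itv/= u1 (le_trans t0).
have below u : t <= u <= 1 -> f u <= rho.
  move=> /andP[tu u1]; have [//|fu] := lerP (f u) rho; exfalso.
  have [||c] := @IVT R f u 1 rho u1.
  - apply: continuous_subspaceW fc; apply: subset_itvr; rewrite bnd_simp.
    exact: le_trans tu.
  - by rewrite ge_min le_max (ltW f1) (ltW fu) orbT.
  rewrite in_itv /= => /andP[uc c1] fcr.
  have ct : c = t by apply: late; rewrite ?fcr// c1 (le_trans tu).
  have ut : u = t by apply/eqP; rewrite eq_le tu -{1}ct uc.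
  by move: fu; rewrite ut -ct fcr ltxx.
exists t; rewrite ?t0//; split=> //.
by apply/eqP; rewrite eq_le ft below// lexx.
Qed.

(** [A] is the part of the John arc after its last entrance into the ball of radius [rho]. The John
    inequality is kept in terms of single distances: the diameter bounds the distance to the tip,
    and the distance to the boundary is at most that to [b]. *)
Lemma john_tail (L : R) Omega z0 z p (rho : R) g : 0 <= L ->
  john_arc Omega L z0 z g -> mdist p z < rho -> rho <= mdist p z0 ->
  exists w A, [/\ connected A, A w, A z, mdist p w = rho &
    forall a, A a -> mdist p a <= rho /\
      forall b, boundary Omega b -> mdist a z <= L * mdist a b].
Proof.
move=> L0 [gc _ [g0 g1] _ gL] pz pz0.
have fc : {within `[0, 1], continuous (mdist p \o g)}.
  by apply: within_continuous_comp gc => x _; exact: mdist_continuous.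
have [||t /andP[t0 t1] [ft tail]] := last_level fc (rho := rho).
- by rewrite /= g1.
- by rewrite /= g0.
exists (g t), (g @` `[t, 1]); split=> //.
- apply: connected_continuous_connected; first exact: segment_connected.
  by apply: continuous_subspaceW gc; apply: subset_itvr; rewrite bnd_simp.
- by exists t => //; rewrite /= in_itv/= lexx.
- by exists 1 => //; rewrite /= in_itv/= lexx t1.
move=> _ [u /= + <-]; rewrite in_itv /= => /andP[tu u1]; split.
  by apply: tail; rewrite tu.
move=> b Fb; rewrite -lee_fin EFinM.
have := gL u; rewrite u1 (le_trans t0 tu) => /(_ isT) diamu.
apply: (@le_trans _ _ (diam (g @` `[u, 1]))).
  apply: ereal_sup_ubound; exists (g u, z) => //; split => /=.
    by exists u => //; rewrite /= in_itv/= lexx.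
  by exists 1 => //; rewrite /= in_itv/= lexx u1.
apply: (le_trans diamu); apply: lee_wpmul2l; first by rewrite lee_fin.
by apply: ereal_inf_lbound; exists b.
Qed.

Lemma open_away Omega z : open Omega -> Omega z ->
  exists2 e : R, 0 < e & forall b, boundary Omega b -> e <= mdist z b.
Proof.
move=> oO Oz; have /nbhs_ballP[e /= e0 zO] := open_nbhs_nbhs (conj oO Oz).
exists e => // b [_ nb]; rewrite leNgt; apply/negP => zb; apply: nb.
by apply: (open_nbhs_nbhs (conj oO _)); apply: zO; rewrite ballEmdist.
Qed.

(** Finitely many grid squares cover the ball in the chart. One point of [Omega] chosen for each
    occupied square serves the whole square, so a single [e] suffices. *)
Lemma boundary_approx Omega p (eps : R) : open Omega -> 0 < eps ->
  exists2 e : R, 0 < e & forall y, boundary Omega y -> mdist p y <= 1 / 4 ->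
    exists z, [/\ Omega z, mdist z y <= eps &
      forall b, boundary Omega b -> e <= mdist z b].
Proof.
move=> oO eps0.
have [phi [phip phiP]] := sphere_chart p.
pose h := eps / 6; have h0 : 0 < h by rewrite divr_gt0.
pose M := Num.bound (1 / 4 / h).
have Mh : 1 / 4 <= M%:R * h.
  by rewrite -ler_pdivrMr//; apply/ltW/archi_boundP; rewrite divr_ge0 ?ltW.
have [f fP] := @grid_classes R h M h0.
have normphi y : mdist p y <= 1 / 4 -> `|phi y| <= M%:R * h.
  move=> py; have [||+ _] := phiP p y; rewrite ?phip ?sub0r ?normrN ?mdistxx//.
  by move=> h1; apply: (le_trans h1); exact: le_trans Mh.
have [||e e0 eP] := @finite_common_pos R _ (fun g e => forall y, boundary Omega y ->
  mdist p y <= 1 / 4 -> f (phi y) = g ->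
  exists z, [/\ Omega z, mdist z y <= eps &
      forall b, boundary Omega b -> e <= mdist z b]).
- move=> g.
  have [[y [Fy py yg]]|none] := pselect (exists y,
      [/\ boundary Omega y, mdist p y <= 1 / 4 & f (phi y) = g]); last first.
    by exists 1 => // y Fy py yg; case: none; exists y.
  have [z [Oz yz]] : Omega `&` ball y (eps / 2) !=set0.
    by apply: Fy.1; apply: nbhsx_ballx; rewrite divr_gt0.
  have [e e0 ez] := open_away oO Oz.
  exists e => // y' Fy' py' y'g; exists z; split=> //.
  have := fP (phi y) (phi y') (normphi _ py) (normphi _ py'); rewrite yg y'g.
  have [_ +] := phiP y y' py py'.
  move: yz; rewrite ballEmdist/= [mdist y z]metric_sym => yz d1 /(_ erefl) d2.
  have := metric_triangle z y y'; rewrite /h in d2; lra.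
- move=> g e e' ee' H y Fy py yg; have [z [Oz zy ze]] := H y Fy py yg.
  by exists z; split=> // b Fb; exact: le_trans (ze b Fb).
by exists e => // y Fy py; exact: (eP (f (phi y))).
Qed.

End JohnTail.

(** * Linking boundary points *)

Section Local.
Variables (R : realType) (T : metricType R) (L : R) (F : set T).
Variables (p : T) (phi : T -> R * R).
Variables (n : nat) (x : 'I_n -> T) (r eps s h : R).
Hypotheses (L1 : 1 <= L) (Fp : F p) (r4 : r <= 1 / 4).
Hypotheses (s0 : 0 < s) (h0 : 0 < h).
Hypothesis phiP : forall a b, mdist p a <= 1 / 4 -> mdist p b <= 1 / 4 ->
  `|phi a - phi b| <= mdist a b /\ mdist a b <= 3 * `|phi a - phi b|.

(** A finite-scale substitute for the component of [x i] in the part of [F] inside the ball of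
    radius [r]. *)
Definition piece (i : 'I_n) : set T :=
  [set b | chain mdist (F `&` [set a | mdist p a <= r]) eps (x i) b].

Hypothesis unlinked : forall i j, i != j -> ~ piece i (x j).

(** A place for a thickened John arc leading to piece [i]. Its distance to all the other pieces is
    built in, while two hubs are told apart by their radii. *)
Definition hub (i : 'I_n) (lo hi : R) : set (R * R) :=
  [set u | exists2 a, lo <= mdist p a <= hi & `|u - phi a| <= h /\
    forall j b, j != i -> piece j b -> 10 * s <= `|u - phi b|].

Definition arm (i : 'I_n) (hi : R) : set (R * R) :=
  [set u | exists2 a, mdist p a <= hi & piece i a /\ u = phi a].

Definition tip (lo hi : R) : set (R * R) :=
  [set u | exists2 a, lo <= mdist p a <= hi & `|u - phi a| <= h].

Lemma piece_sub i b : piece i b -> F b /\ mdist p b <= r.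
Proof. by move=> ib; have [_ []] := chain_in ib. Qed.

(** A step of length at most [eps] between two pieces would link [x i] to [x j]. *)
Lemma piece_far i j a b : i != j -> piece i a -> piece j b -> eps < mdist a b.
Proof.
move=> ij ia jb; rewrite ltNge; apply/negP => ab; apply: (unlinked ij).
apply: (chain_trans ia); apply: (@chain_trans _ _ _ _ _ b).
  by apply: chain_step (piece_sub ia) (piece_sub jb) ab.
by apply: chain_sym jb; exact: metric_sym.
Qed.

(** Three stretches: a segment from [phi w'] to [phi w], the John arc from [w] to [z], and a segment
    from [phi z] to [phi y]. Other pieces are kept away on the first by the John condition at [w],
    on the second by the distance [e] of [z] from [F], and on the third by [piece_far]. *)
Lemma hub_chain i (lo rho1 rho2 e eps' : R) y z w A :
  piece i y -> mdist z y <= eps' -> (forall b, F b -> e <= mdist z b) ->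
  connected A -> A w -> A z -> mdist p w = rho2 ->
  (forall a, A a -> mdist p a <= rho2 /\
     forall b, F b -> mdist a z <= L * mdist a b) ->
  mdist p y <= rho1 -> rho1 <= rho2 -> rho2 <= r -> eps' <= h ->
  lo <= mdist p y -> lo * (1 + L) <= mdist p y - eps' ->
  3 * L * (10 * s + h) <= rho2 - rho1 - eps' ->
  3 * (1 + L) * (10 * s) <= e ->
  3 * (10 * s + eps') <= eps ->
  forall w', `|phi w - phi w'| <= h ->
  chain (@plane_dist R) (hub i lo rho2) s (phi w') (phi y).
Proof.
move=> iy zy ez cA Aw Az pw tail py rho12 rho2r eps'h loy loy' E1 E2 E3 w' ww'.
have L1' := L1; have r4' := r4.
have L0 : 0 < L by lra.
have [Fy yr] := piece_sub iy.
have y4 : mdist p y <= 1 / 4 by lra.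
have A4 a : A a -> mdist p a <= 1 / 4 by move=> /tail[]; lra.
(* Since [p] lies in [F], the John condition gives [mdist p z <= (1 + L) * mdist p a]: an arc with a
   distant tip cannot come close to [p]. *)
have low a : A a -> lo <= mdist p a.
  move=> Aa; have [_ /(_ p Fp)] := tail a Aa.
  rewrite [mdist a p]metric_sym => az.
  have := metric_triangle p a z; have := metric_triangle p z y => t1 t2.
  rewrite -(@ler_pM2r _ (1 + L)); last by lra.
  lra.
have piece4 j b : piece j b -> F b /\ mdist p b <= 1 / 4.
  by move=> /piece_sub[Fb br]; split=> //; lra.
apply: (@chain_trans _ _ _ _ _ (phi w)).
- apply: chain_sym; first by move=> u v; rewrite /plane_dist distrC.
  apply: chain_sub (plane_chain_ball s0 ww') => // u /= uw.
  exists w; first by rewrite pw lexx andbT -pw; exact: low.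
  split=> // j b ji /piece4[Fb b4].
  have [_ d3] := phiP (A4 _ Aw) b4.
  have [_ /(_ b Fb) d1] := tail w Aw.
  have d2 : 10 * s + h <= `|phi w - phi b|.
    rewrite -(@ler_pM2l _ (3 * L)); last by rewrite mulr_gt0.
    have := metric_triangle p z w; have := metric_triangle p y z.
    rewrite [mdist z w]metric_sym [mdist y z]metric_sym pw => t1 t2.
    have : L * mdist w b <= L * (3 * `|phi w - phi b|) by rewrite ler_pM2l.
    lra.
  have := ler_distD u (phi w) (phi b); rewrite [ `|phi w - u|]distrC; lra.
apply: (@chain_trans _ _ _ _ _ (phi z)).
- apply: chain_map (connected_chain cA s0 Aw Az) => [a Aa|a b Aa Ab ab]; last first.
    by apply: (le_trans _ ab); exact: (phiP (A4 _ Aa) (A4 _ Ab)).1.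
  exists a; first by rewrite low//; exact: (tail a Aa).1.
  rewrite subrr normr0 ltW//; split=> // j b ji /piece4[Fb b4].
  have [_ d3] := phiP (A4 _ Aa) b4.
  have [_ /(_ b Fb) d1] := tail a Aa.
  rewrite -(@ler_pM2l _ (3 * (1 + L))); last by rewrite mulr_gt0//; lra.
  apply: (le_trans E2); apply: (le_trans (ez b Fb)).
  have := metric_triangle z a b; rewrite [mdist z a]metric_sym => t1.
  have : (1 + L) * mdist a b <= (1 + L) * (3 * `|phi a - phi b|).
    by rewrite ler_pM2l//; lra.
  lra.
have yz : `|phi y - phi z| <= eps'.
  by apply: (le_trans (phiP y4 (A4 _ Az)).1); rewrite metric_sym.
apply: chain_sym; first by move=> u v; rewrite /plane_dist distrC.
apply: chain_sub (plane_chain_ball s0 yz) => // u /= uy.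
exists y; first by rewrite loy; lra.
split=> [|j b ji jb]; first lra.
have [Fb b4] := piece4 j b jb.
have := piece_far ji jb iy; have [_ d3] := phiP y4 b4.
rewrite metric_sym => yb.
have := ler_distD u (phi y) (phi b); rewrite [ `|phi y - u|]distrC; lra.
Qed.

Lemma arm_chain i (rho : R) y : s <= eps -> rho + s <= r ->
  mdist p (x i) < rho -> rho <= mdist p y -> chain mdist F s (x i) y ->
  exists y', [/\ rho <= mdist p y' <= rho + s, piece i y' &
    chain (@plane_dist R) (arm i (rho + s)) s (phi y') (phi (x i))].
Proof.
move=> seps rhor xrho rhoy xy; have r4' := r4.
have [|y' py' xy'] := chain_exit (f := mdist p) s0 _ xrho rhoy xy.
  by move=> a b; exact: metric_triangle.
have sub a : chain mdist (F `&` [set a | mdist p a <= rho + s]) s (x i) a -> piece i a.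
  by apply: chain_sub => // b [Fb /= bs]; split=> //=; lra.
exists y'; split=> //; first exact: sub.
apply: chain_sym; first by move=> u v; rewrite /plane_dist distrC.
apply: chain_map (chain_reach xy') => [a /= xa|a b /= xa xb ab].
  by exists a; [have [_ []] := chain_in xa|split=> //; exact: sub].
have [_ [_ /= a4]] := chain_in xa; have [_ [_ /= b4]] := chain_in xb.
by apply: (le_trans _ ab); apply: (phiP _ _).1; lra.
Qed.

Lemma radial_sep (a b : T) (lo hi : R) u v (hu hv : R) :
  mdist p a <= hi -> lo <= mdist p b <= 1 / 4 -> hi <= 1 / 4 ->
  `|u - phi a| <= hu -> `|v - phi b| <= hv ->
  3 * (10 * s + hu + hv) <= lo - hi -> 10 * s <= `|u - v|.
Proof.
move=> ahi /andP[blo b4] hi4 ua vb E.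
have [|_ d] := @phiP a b _ b4; first lra.
have := metric_triangle p a b => t1.
have := ler_distD u (phi a) (phi b); have := ler_distD v u (phi b).
rewrite [ `|phi a - u|]distrC; lra.
Qed.

(* The three hubs and the three pieces would be the vertices of [K_{3,3}]. *)
Lemma no_common_hubs (t l : R) (idx : nat -> 'I_n) (w w' y : 'I_n -> T) :
  0 < t -> t <= l -> 40 * l <= r -> 30 * s + 6 * h <= t -> 30 * s <= eps ->
  s <= t ->
  (forall j k, (j < 3)%N -> (k < 3)%N -> j != k -> idx j != idx k) ->
  (forall i, forall v, `|phi (w i) - phi v| <= h ->
    chain (@plane_dist R) (hub i (- t) (2 * t)) s (phi v) (phi (x i))) ->
  (forall i, forall v, `|phi (w' i) - phi v| <= h ->
    chain (@plane_dist R) (hub i (4 * t) (20 * l) `|` arm i (10 * l + s)) s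
      (phi v) (phi (x i))) ->
  (forall i, 30 * l <= mdist p (y i) <= 30 * l + s /\
    chain (@plane_dist R) (arm i (30 * l + s)) s (phi (y i)) (phi (x i))) ->
  (forall j, (j < 3)%N -> `|phi (w (idx j)) - phi (w (idx 0%N))| <= h) ->
  (forall j, (j < 3)%N -> `|phi (w' (idx j)) - phi (w' (idx 0%N))| <= h) ->
  (forall j, (j < 3)%N -> `|phi (y (idx j)) - phi (y (idx 0%N))| <= h) ->
  False.
Proof.
move=> t0 tl lr sht s30 st inj inner outer outermost cw cw' cy.
have r4' := r4; have s0' := s0; have h0' := h0.
pose a (m : nat) := match m with
  | 0 => phi (w (idx 0%N)) | 1 => phi (w' (idx 0%N)) | _ => phi (y (idx 0%N)) end.
(* Hubs are far from the arms of other pieces by definition, and arms from each other by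
   [piece_far]. All remaining pairs are separated radially: up to [2 * t], from [4 * t] to [20 * l],
   and near [30 * l]. *)
pose E (m j : nat) := let i := idx j in match m with
  | 0 => hub i (- t) (2 * t)
  | 1 => hub i (4 * t) (20 * l) `|` arm i (10 * l + s)
  | _ => tip (30 * l) (30 * l + s) `|` arm i (30 * l + s) end.
have hub_arm i j lo hi hi' u v : i != j -> hub i lo hi u -> arm j hi' v ->
    10 * s <= `|u - v|.
  by move=> ij [c _ [_ H]] [b _ [jb ->]]; apply: H jb; rewrite eq_sym.
have arm_arm i j hi hi' u v : i != j -> arm i hi u -> arm j hi' v ->
    10 * s <= `|u - v|.
  move=> ij [c _ [ic ->]] [b _ [jb ->]].
  have := piece_far ij ic jb.
  have [_ c4] := piece_sub ic; have [_ b4] := piece_sub jb.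
  by have [||_] := @phiP c b; lra.
have hub_tip i lo hi u v : hi <= 20 * l -> hub i lo hi u ->
    tip (30 * l) (30 * l + s) v -> 10 * s <= `|u - v|.
  move=> hil [c /andP[_ ch] [uc _]] [b /andP[b1 b2] vb].
  by apply: (radial_sep (a := c) (b := b) (hi := hi) (lo := 30 * l) _ _ _ uc vb);
    rewrite ?b1; lra.
have arm_tip i u v : arm i (10 * l + s) u ->
    tip (30 * l) (30 * l + s) v -> 10 * s <= `|u - v|.
  move=> [c ch [_ ->]] [b /andP[b1 b2] vb].
  have cc : `|phi c - phi c| <= 0 by rewrite subrr normr0.
  by apply: (radial_sep (a := c) (b := b) (hi := 10 * l + s) (lo := 30 * l)
    _ _ _ cc vb); rewrite ?b1; lra.
apply: (@no_K33 R s a (fun j => phi (x (idx j))) E s0).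
- move=> [|[|m]] j _ j3 /=.
  + exact/inner/cw.
  + exact/outer/cw'.
  + have [y30 yx] := outermost (idx j).
    apply: (chain_trans (y := phi (y (idx j)))).
      apply: chain_sym; first by move=> u v; rewrite /plane_dist distrC.
      apply: chain_sub (plane_chain_ball s0 (cy j j3)) => // u uy.
      by left; exists (y (idx j)).
    by apply: chain_sub yx => // u; right.
- move=> m k j i u v m3 k3 j3 i3 mk /(inj _ _ j3 i3) ji.
  case: m mk m3 => [|[|m]] //=; case: k k3 => [|[|[|k]]] //= _ _ _.
  + move=> Eu [Ev|]; last exact: hub_arm ji Eu.
    case: Eu Ev => [c /andP[_ ch] [uc _]] [b /andP[b1 b2] [vb _]].
    by apply: (radial_sep (a := c) (b := b) (hi := 2 * t) (lo := 4 * t) _ _ _ uc vb);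
      rewrite ?b1; lra.
  + by move=> Eu [|]; [apply: (hub_tip _ _ _ _ _ _ Eu); lra|exact: hub_arm ji Eu].
  + move=> [Eu|Eu] [Ev|Ev].
    * exact: hub_tip (lexx _) Eu Ev.
    * exact: hub_arm ji Eu Ev.
    * exact: arm_tip Eu Ev.
    * exact: arm_arm ji Eu Ev.
Qed.

End Local.

(** [D] is half the distance between two fixed points of [F]; no [p] can be closer than that to
    both. *)
Lemma far_point (R : realType) (T : metricType R) (F : set T) :
  exists2 D : R, 0 < D & forall p, F p ->
    (forall a b, F a -> F b -> a = b) \/ exists2 f, F f & D <= mdist p f.
Proof.
have [[a [b [Fa Fb ab]]]|none] := pselect (exists a b, [/\ F a, F b & a != b]).
  exists (mdist a b / 2); first by rewrite divr_gt0// mdist_gt0.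
  move=> p Fp; right.
  have := metric_triangle a p b; rewrite [mdist a p]metric_sym => t1.
  have [pa|pa] := lerP (mdist a b / 2) (mdist p a); first by exists a.
  by exists b => //; lra.
exists 1 => // p _; left => a b Fa Fb; apply/eqP/negPn/negP => ab.
by apply: none; exists a, b.
Qed.

Definition grid_type (M : nat) : finType := ('I_(2 * M).+1 * 'I_(2 * M).+1)%type.

(** One square for each of the three data: the two entrance points and the boundary point at
    distance about [30 * (L * t)]. *)
Definition grid_type3 (M : nat) : finType :=
  (grid_type M * grid_type M * grid_type M)%type.

(** The argument at one scale. If all points were unlinked, the pigeonhole principle would give
    three whose data share their grid squares, against [no_common_hubs]. *)
Lemma linked_points (R : realType) (T : metricType R) (F Om : set T) (L t : R)
    (M : nat) (p f : T) (phi : T -> R * R)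
    (x : 'I_(2 * #|grid_type3 M|).+1 -> T) :
  let r := 40 * (L * t) in
  1 <= L -> 400 * L ^+ 2 <= M%:R -> 0 < t -> r <= 1 / 4 ->
  phi p = 0 ->
  (forall a b, mdist p a <= 1 / 4 -> mdist p b <= 1 / 4 ->
    `|phi a - phi b| <= mdist a b /\ mdist a b <= 3 * `|phi a - phi b|) ->
  connected F -> F p -> F f -> r <= mdist p f ->
  (forall eps, 0 < eps -> exists2 e : R, 0 < e & forall y, F y ->
    mdist p y <= 1 / 4 -> exists z, [/\ Om z, mdist z y <= eps &
      forall b, F b -> e <= mdist z b]) ->
  (forall z rho, Om z -> mdist p z < rho -> rho <= r -> exists w A,
    [/\ connected A, A w, A z, mdist p w = rho & forall a, A a ->
      mdist p a <= rho /\ forall b, F b -> mdist a z <= L * mdist a b]) ->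
  (forall i, F (x i) /\ mdist p (x i) < t) ->
  forall eps, 0 < eps -> exists i j, i != j /\
    chain mdist (F `&` [set a | mdist p a <= r]) eps (x i) (x j).
Proof.
move=> r L1 M400 t0 r4 phip phiP cF Fp Ff rf approx tail xt eps1 eps1_gt.
have L0 : 0 < L by lra.
have Ln0 : L != 0 by rewrite gt_eqF.
have rE : r = 40 * (L * t) by [].
have Lt : t <= L * t by rewrite ler_peMl// ltW.
apply: contrapT => unl.
pose eps := Num.min eps1 t.
have eps_gt : 0 < eps by rewrite lt_min eps1_gt.
have epst : eps <= t by rewrite ge_min lexx orbT.
have unlinked i j : i != j -> ~ piece F p x r eps i (x j).
  move=> ij ijl; apply: unl; exists i, j; split=> //.
  by apply: chain_sub ijl => //; rewrite ge_min lexx.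
(* The ratio [r / h] is [400 * L ^+ 2] whatever [t] is, so the grid has a size depending on [L]
   only. *)
pose h := t / (10 * L).
have h0 : 0 < h by rewrite divr_gt0// mulr_gt0.
have Lh : L * h = t / 10 by rewrite /h; field.
have hLh : h <= L * h by rewrite ler_peMl// ltW.
pose eps' := eps / (10 * L).
have eps'0 : 0 < eps' by rewrite divr_gt0// mulr_gt0.
have Le' : L * eps' = eps / 10 by rewrite /eps'; field.
have eLe : eps' <= L * eps' by rewrite ler_peMl// ltW.
have eh : eps' <= h by rewrite -(ler_pM2l L0) Lh Le'; lra.
have [e e_gt approx_e] := approx eps' eps'0.
(* The step [s] comes last because [e] is not controlled by [t]. It only refines the chains and does
   not enter the number of grid squares. *)
pose s := Num.min (e / (60 * L)) (eps / (100 * L)).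
have s0 : 0 < s by rewrite lt_min !divr_gt0// mulr_gt0.
have se : 60 * (L * s) <= e.
  rewrite mulrA mulrC -ler_pdivlMr ?mulr_gt0// ge_min lexx//.
have seps : 100 * (L * s) <= eps.
  rewrite mulrA mulrC -ler_pdivlMr ?mulr_gt0// ge_min lexx orbT//.
have sLs : s <= L * s by rewrite ler_peMl// ltW.
have rMh : r <= M%:R * h.
  have : 400 * L ^+ 2 * h <= M%:R * h by rewrite ler_pM2r.
  suff -> : 400 * L ^+ 2 * h = r by [].
  by rewrite rE /h; field.
clear M400 approx.
clearbody r eps h eps' s.
have xx i : piece F p x r eps i (x i).
  by apply: chain_refl; split; [exact: (xt i).1|have := (xt i).2; rewrite /=; lra].
have Hub := hub_chain L1 Fp r4 s0 h0 phiP unlinked.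
have Arm i rho : rho + s <= r -> mdist p (x i) < rho -> exists y',
    [/\ rho <= mdist p y' <= rho + s, piece F p x r eps i y' &
    chain (@plane_dist R) (arm F p phi x r eps i (rho + s)) s
      (phi y') (phi (x i))].
  move=> rho_r xrho; apply: (arm_chain (y := f) r4 s0 phiP _ rho_r xrho); first by lra.
    by apply: (le_trans _ rf); lra.
  by apply: connected_chain => //; exact: (xt i).1.
have xpos i := mdist_ge0 p (x i).
have inner i : exists2 w, mdist p w = 2 * t & forall w', `|phi w - phi w'| <= h ->
    chain (@plane_dist R) (hub F p phi x r eps s h i (- t) (2 * t)) s
      (phi w') (phi (x i)).
  have [Fx xt'] := xt i; have xi0 := xpos i.
  have [z [Oz zx ez]] : exists z, [/\ Om z, mdist z (x i) <= eps' &
      forall b, F b -> e <= mdist z b] by apply: approx_e => //; lra.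
  have [||w [A [cA Aw Az pw Atail]]] := @tail z (2 * t) Oz.
    by have := metric_triangle p (x i) z; rewrite [mdist (x i) z]metric_sym; lra.
    by lra.
  exists w => // w' ww'.
  have tL0 : 0 <= t * L by rewrite mulr_ge0 ?ltW.
  (* The lower radius [- t] restricts nothing. A radius 0 would require [eps' <= mdist p (x i)],
     which fails when [x i] is [p]. *)
  apply: (Hub i (- t) t (2 * t) e eps' (x i) z w A) => //;
    clear - L1 L0 r4 rE t0 Lt epst eps_gt Lh hLh Le' eLe eh se seps sLs s0 xt' xi0 tL0; lra.
have outer i : exists2 w, mdist p w = 20 * (L * t) &
    forall w', `|phi w - phi w'| <= h ->
    chain (@plane_dist R) (hub F p phi x r eps s h i (4 * t) (20 * (L * t))
      `|` arm F p phi x r eps i (10 * (L * t) + s)) s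
      (phi w') (phi (x i)).
  have [Fx xt'] := xt i.
  have [||y [/andP[y1 y2] iy yx]] := Arm i (10 * (L * t));
    try by clear - L1 L0 r4 rE t0 Lt epst eps_gt Lh hLh Le' eLe eh se seps sLs s0 xt'; lra.
  have [Fy _] := piece_sub iy.
  have [z [Oz zy ez]] : exists z, [/\ Om z, mdist z y <= eps' &
      forall b, F b -> e <= mdist z b] by apply: approx_e => //; lra.
  have [||w [A [cA Aw Az pw Atail]]] := @tail z (20 * (L * t)) Oz.
  - by have := metric_triangle p y z; rewrite [mdist y z]metric_sym; lra.
  - by lra.
  exists w => // w' ww'; apply: (chain_trans (y := phi y)); last first.
    by apply: chain_sub yx => // u; right.
  suff : chain (@plane_dist R) (hub F p phi x r eps s h i (4 * t) (20 * (L * t)))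
      s (phi w') (phi y) by apply: chain_sub => // u; left.
  (* The tip is near [y], at distance at least [10 * (L * t)] from [p]. Lower radius [4 * t] is
     allowed because [4 * t * (1 + L) <= 8 * (L * t)]. *)
  apply: (Hub i (4 * t) (10 * (L * t) + s) (20 * (L * t)) e eps' y z w A) => //;
    clear - L1 L0 r4 rE t0 Lt epst eps_gt Lh hLh Le' eLe eh se seps sLs s0 y1 y2; lra.
have outermost i : exists2 y, 30 * (L * t) <= mdist p y <= 30 * (L * t) + s &
    chain (@plane_dist R) (arm F p phi x r eps i (30 * (L * t) + s)) s
      (phi y) (phi (x i)).
  have [Fx xt'] := xt i.
  have [||y [y1 _ yx]] := Arm i (30 * (L * t));
    try by clear - L1 L0 r4 rE t0 Lt epst eps_gt Lh hLh Le' eLe eh se seps sLs s0 xt'; lra.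
  by exists y.
have [W hW] := choice (fun i => let: ex_intro2 w h1 h2 := inner i in
  ex_intro (fun w => _ /\ _) w (conj h1 h2)).
have [W' hW'] := choice (fun i => let: ex_intro2 w h1 h2 := outer i in
  ex_intro (fun w => _ /\ _) w (conj h1 h2)).
have [Y hY] := choice (fun i => let: ex_intro2 w h1 h2 := outermost i in
  ex_intro (fun w => _ /\ _) w (conj h1 h2)).
have [f0 f0P] := @grid_classes R h M h0.
have phi_le b : mdist p b <= r -> `|phi b| <= M%:R * h.
  move=> br; have p4 : mdist p p <= 1 / 4 by rewrite mdistxx divr_ge0.
  have b4 : mdist p b <= 1 / 4 := le_trans br r4.
  have [+ _] := phiP _ _ p4 b4; rewrite phip sub0r normrN.
  by move=> h1; apply: (le_trans h1); exact: le_trans rMh.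
have close b c : mdist p b <= r -> mdist p c <= r -> f0 (phi b) = f0 (phi c) ->
    `|phi b - phi c| <= h by move=> /phi_le ? /phi_le ?; exact: f0P.
pose cl i : grid_type3 M := (f0 (phi (W i)), f0 (phi (W' i)), f0 (phi (Y i))).
have [|i0 [i1 [i2 [i01 i12 i20]]]] := @pigeonhole3 _ _ cl.
  by rewrite card_ord.
move=> cl01 cl12.
pose idx j := match j with 0%N => i0 | 1%N => i1 | _ => i2 end.
have clE j : cl (idx j) = cl (idx 0%N).
  by case: j => [|[|j]] //=; rewrite cl01// cl12.
have Wr i : mdist p (W i) <= r by rewrite (hW i).1; clear - rE t0 Lt; lra.
have W'r i : mdist p (W' i) <= r by rewrite (hW' i).1; clear - rE t0 Lt; lra.
have Yr i : mdist p (Y i) <= r.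
  have [/andP[_ Yi] _] := hY i.
  by clear - Yi rE t0 Lt sLs seps epst; lra.
apply: (@no_common_hubs _ _ F p phi _ x r eps s h r4 s0 h0 phiP unlinked t
  (L * t) idx W W' Y) => //;
  try by clear - L1 L0 r4 rE t0 Lt epst eps_gt Lh hLh Le' eLe eh se seps sLs s0; lra.
- clear - i01 i12 i20.
  by move=> [|[|[|j]]] [|[|[|k]]] //= _ _ _; rewrite // eq_sym.
- by move=> i; exact: (hW i).2.
- by move=> i; exact: (hW' i).2.
- by move=> j _; apply: close => //; case: (clE j).
- by move=> j _; apply: close => //; case: (clE j).
- by move=> j _; apply: close => //; case: (clE j).
Qed.


(** [N] is fixed before [Omega]; only the range of scales [kappa] depends on the domain, which is
    harmless since the scales of a weak tangent tend to 0. *)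
Lemma linked_boundary_points (R : realType) (L : R) : 1 <= L ->
  exists N : nat, forall Omega : set (riemann_sphere R),
  john_domain L Omega -> connected (boundary Omega) ->
  exists2 kappa : R, 0 < kappa & forall p t (x : 'I_N.+1 -> riemann_sphere R),
    boundary Omega p -> 0 < t <= kappa ->
    (forall i, boundary Omega (x i) /\ mdist p (x i) < t) ->
    forall eps, 0 < eps -> exists i j, i != j /\
      chain mdist (boundary Omega `&` [set a | mdist p a <= 40 * (L * t)]) eps
        (x i) (x j).
Proof.
move=> L1; have L0 : 0 < L by lra.
have Ln0 : L != 0 by rewrite gt_eqF.
pose M := Num.bound (400 * L ^+ 2).
have M400 : 400 * L ^+ 2 <= M%:R.
  exact/ltW/archi_boundP/(mulr_ge0 (ler0n _ _) (sqr_ge0 _)).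
exists (2 * #|grid_type3 M|)%N => Omega [[oO _] [z0 Oz0 arcs]] cF.
set F := boundary Omega in cF *.
have [e0 e0_gt z0F] := open_away oO Oz0.
have [D D0 far] := far_point F.
(* The three bounds keep [z0] out of the ball of radius [r], make [F] reach beyond that ball, and
   keep the ball inside the chart. *)
pose m := Num.min e0 (Num.min D (1 / 4)).
have m0 : 0 < m by rewrite !lt_min e0_gt D0/=; lra.
exists (m / (40 * L)); first by rewrite divr_gt0// mulr_gt0.
move=> p t x Fp /andP[t0 tk] xt eps1 eps1_gt.
pose r := 40 * (L * t).
have rE : r = 40 * (L * t) by [].
have rm : r <= m.
  by move: tk; rewrite ler_pdivlMr ?mulr_gt0//; lra.
have re0 : r <= e0 by apply: (le_trans rm); rewrite ge_min lexx.
have rD : r <= D by apply: (le_trans rm); rewrite !ge_min lexx !orbT.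
have r4 : r <= 1 / 4 by apply: (le_trans rm); rewrite !ge_min lexx !orbT.
have Lt : t <= L * t by rewrite ler_peMl// ltW.
have [sub|[f Ff Df]] := far p Fp.
  (* When [F] is a single point all the [x i] coincide, and any two distinct indices will do. *)
  have G1 : (1 < (2 * #|grid_type3 M|).+1)%N.
    rewrite ltnS muln_gt0/=; apply/card_gt0P.
    by exists ((ord0, ord0), (ord0, ord0), (ord0, ord0)).
  exists ord0, (Ordinal G1); split => //.
  rewrite (sub _ _ (xt ord0).1 (xt (Ordinal G1)).1); apply: chain_refl.
  by split; [exact: (xt _).1|have := (xt (Ordinal G1)).2; rewrite /=; lra].
have [phi [phip phiP]] := sphere_chart p.
apply: (linked_points L1 M400 t0 r4 phip phiP cF Fp Ff) xt eps1 eps1_gt.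
- exact: le_trans Df.
- by move=> eps; exact: boundary_approx.
move=> z rho Oz pz rho_r.
have pz0 : rho <= mdist p z0.
  by rewrite metric_sym; have := z0F p Fp; lra.
have zz0 : z <> z0 by move=> zz0; move: pz; rewrite zz0; lra.
have [g hg] := arcs z Oz zz0.
exact: (john_tail (ltW L0) hg pz pz0).
Qed.

(** * Weak tangents *)

Section Compactness.
Variables (R : realType) (Y : completeMetricType R).
Implicit Types (K A : set Y) (q y z : Y).

(** Total boundedness, encoded by finite colourings with classes of small diameter. *)
Definition finitely_covered A := forall eta : R, 0 < eta ->
  exists (G : finType) (c : Y -> G), forall y z, A y -> A z -> c y = c z ->
    mdist y z < eta.

Definition cball q (rho : R) : set Y := [set y | mdist q y <= rho].

Lemma closed_cball q rho : closed (cball q rho).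
Proof. by apply: closed_comp (@closed_le _ rho) => y _; exact: mdist_continuous. Qed.

(** An ultrafilter containing [A] selects one colour at each scale, so it is Cauchy and converges by
    completeness. *)
Lemma finitely_covered_compact A : closed A -> finitely_covered A -> compact A.
Proof.
move=> cA fA; rewrite compact_ultra => F UF FA.
have cauchyF : cauchy F.
  apply: cauchy_exP => eta eta0; have [G [c cP]] := fA eta eta0.
  have [[g Fg]|none] := pselect (exists g, F (A `&` [set y | c y = g])).
    have [y [Ay yg]] := filter_ex Fg.
    exists y; apply: filterS Fg => z [Az zg]; rewrite ballEmdist /=.
    by apply: cP => //; rewrite yg zg.
  have Fn g : F (~` (A `&` [set y | c y = g])).
    have [Fg|//] := in_ultra_setVsetC (A `&` [set y | c y = g]) UF.
    by case: none; exists g.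
  have [y [Ay nall]] := filter_ex (filterI FA (filter_forall _ Fn)).
  by case: (nall (c y)).
have /cauchy_cvgP/cvg_ex[l Fl] := cauchyF.
exists l; split => //; apply: cA => B /Fl FB.
exact: filter_ex (filterI FA FB).
Qed.

(** The sets are not assumed closed, so the conclusion is a cluster point of the decreasing family
    rather than a common point. *)
Lemma compact_nested K (S : R -> set Y) : compact K ->
  (forall e, 0 < e -> S e !=set0) -> (forall e, S e `<=` K) ->
  (forall e e', e <= e' -> S e `<=` S e') ->
  exists2 z, K z & forall e, 0 < e -> exists2 w, S e w & mdist z w < e.
Proof.
move=> cK S0 SK Smono.
pose F : set_system Y := filter_from [set e : R | 0 < e] S.
have FF : ProperFilter F.
  apply: filter_from_proper; last by move=> e; exact: S0.
  apply: filter_from_filter; first by exists 1 => /=.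
  move=> e e' /= e0 e'0; exists (Num.min e e'); first by rewrite /= lt_min e0.
  by move=> z Sz; split; apply: Smono Sz; rewrite ge_min lexx ?orbT.
have [z [Kz Fz]] : K `&` cluster F !=set0.
  by apply: cK; exists 1 => //=; exact: SK.
exists z => // e e0.
have [||w [Sw zw]] := Fz (S e) (ball z e).
- by exists e.
- exact: nbhsx_ballx.
by exists w => //; move: zw; rewrite ballEmdist.
Qed.

(** The set [A] of points chained to [y] at every scale is connected. Two separated parts of it
    would have positive distance, and fine chains between them would pass through points far from
    [A]; these would accumulate at a point of [A]. *)
Lemma chained_same_component K y z : compact K ->
  (forall e : R, 0 < e -> chain mdist K e y z) ->
  connected_component [set: Y] y = connected_component [set: Y] z.
Proof.
move=> cK yz; apply: same_connected_component.
pose A := [set w | forall e : R, 0 < e -> chain mdist K e y w].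
have [Ky _] := chain_in (yz 1 ltr01).
have AK : A `<=` K by move=> w /(_ 1 ltr01) yw; have [] := chain_in yw.
have Ay : A y by move=> e e0; exact: chain_refl.
have A_limit w : K w -> (forall e : R, 0 < e -> exists2 v,
    chain mdist K e y v & mdist w v < e) -> A w.
  move=> Kw H e e0; have [v yv wv] := H e e0.
  apply: (chain_trans yv); apply: chain_step => //.
    by have [] := chain_in yv.
  by rewrite metric_sym ltW.
suff cA : connected A.
  have sub := connected_component_max Ay (@subsetT _ A) cA.
  exact: (sub z yz).
apply: contrapT => /connectedPn[E [E0 AE [sep1 sep2]]].
have EA b : E b `<=` A by rewrite AE => w; case: b => ?; [right|left].
have [d d0 far] : exists2 d : R, 0 < d & forall u v, E false u -> E true v ->
    3 * d <= mdist u v.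
  apply: contrapT => none.
  have [|||w Kw wE] := @compact_nested K
    (fun e => [set u | E false u /\ exists2 v, E true v & mdist u v < e]) cK.
  - move=> e e0; apply: contrapT => Se; apply: none; exists (e / 3).
      by rewrite divr_gt0.
    move=> u v Eu Ev; rewrite leNgt; apply/negP => uv; apply: Se.
    by exists u; split=> //; exists v => //; lra.
  - by move=> e u [/EA/AK].
  - move=> e e' ee' u [Eu [v Ev uv]]; split=> //; exists v => //.
    exact: lt_le_trans ee'.
  have Aw : A w.
    apply: A_limit => // e e0; have [u [Eu _] wu] := wE e e0.
    by exists u => //; exact: EA Eu _ e0.
  have near_w b : closure (E b) w.
    move=> B /nbhs_ballP[e /= e0 wB].
    have e20 : 0 < e / 2 by rewrite divr_gt0.
    have [u [Eu [v Ev uv]] wu] := wE _ e20.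
    have [-> | ->] : b = true \/ b = false by case: (b); [left|right].
      exists v; split=> //; apply: wB; rewrite ballEmdist /=.
      by have := metric_triangle w u v; lra.
    by exists u; split=> //; apply: wB; rewrite ballEmdist /=; lra.
  move: Aw; rewrite AE => -[Ew|Ew].
    by have : set0 w by rewrite -sep2; split.
  by have : set0 w by rewrite -sep1; split.
have [u Eu] := E0 false; have [v Ev] := E0 true.
(* The first chain point at distance at least [d] from [E false] is also that far from [E true]:
   otherwise three lengths, each at most [d] and one strictly smaller, would join the two parts. *)
pose S e := [set w | chain mdist K e y w /\ forall a, A a -> d <= mdist w a].
have [|||w Kw wS] := @compact_nested K S cK.
- move=> e e0; apply: contrapT => Se.
  pose e' := Num.min e d; have e'0 : 0 < e' by rewrite lt_min e0.
  have yu := EA _ _ Eu e' e'0; have yv := EA _ _ Ev e' e'0.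
  have uv : chain mdist K e' u v.
    by apply: chain_trans yv; apply: chain_sym yu; exact: metric_sym.
  suff [a Ea va] : exists2 a, E false a & mdist v a < d.
    by have := far a v Ea Ev; rewrite metric_sym; lra.
  apply: (chain_ind (P := [set w | exists2 a, E false a & mdist w a < d]) _ _ uv).
    by exists u => //; rewrite mdistxx.
  move=> b c Kb Kc ub [a Ea ba] bc; apply: contrapT => nc; apply: Se.
  exists c; split.
    apply: (@chain_trans _ _ _ _ _ u).
      by apply: chain_sub yu => //; rewrite ge_min lexx.
    have uc : chain mdist K e' u c by apply: (chain_trans ub); exact: chain_step.
    by apply: chain_sub uc => //; rewrite ge_min lexx.
  have bcd : mdist b c <= d by apply: (le_trans bc); rewrite ge_min lexx orbT.
  move=> a'; rewrite AE => -[Ea'|Ea']; rewrite leNgt; apply/negP => ca'.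
    by apply: nc; exists a'.
  have := far a a' Ea Ea'; have := metric_triangle a b a'.
  have := metric_triangle b c a'; rewrite [mdist a b]metric_sym; lra.
- by move=> e w [yw _]; have [] := chain_in yw.
- by move=> e e' ee' w [yw H]; split=> //; exact: chain_sub yw.
have Aw : A w.
  by apply: A_limit => // e e0; have [v' [yv' _] wv'] := wS e e0; exists v'.
have [v' [_ H] wv'] := wS d d0.
by have := H w Aw; rewrite metric_sym; lra.
Qed.

End Compactness.

(** * Transfer between the boundary and its tangent *)

Section Transfer.
Variables (R : realType) (F : set (riemann_sphere R)).
Variables (Y : completeMetricType R) (q : Y).
Hypothesis wt : weak_tangent (fun x y : F => mdist (\val x) (\val y)) q.

(* [f] is only meaningful on the points of [F]. *)
Lemma tangent_approximation (kappa eps r : R) : 0 < kappa -> 0 < eps -> 1 <= r ->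
  exists (p : riemann_sphere R) (l : R) (f : riemann_sphere R -> Y),
  [/\ F p, 0 < l < kappa,
    forall y, mdist q y < r -> exists2 a, F a &
      mdist p a < l * r /\ mdist (f a) y < eps,
    forall a, F a -> mdist p a < l * r -> mdist q (f a) < mdist p a / l + eps /\
      mdist p a / l < mdist q (f a) + eps &
    forall a b, F a -> F b -> mdist p a < l * r -> mdist p b < l * r ->
      mdist (f a) (f b) < mdist a b / l + eps /\
      mdist a b / l < mdist (f a) (f b) + eps].
Proof.
case: wt => p [lam [lam0 lamcvg gh]] k0 eps0 r1.
have [n [nk [phi [phip dense isom]]]] := filter_ex
  (filterI (cvgr0_norm_lt _ lamcvg kappa k0) (gh eps r eps0 r1)).
have lift_ex (a : riemann_sphere R) : exists x : F, F a -> \val x = a.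
  have [Fa|nFa] := pselect (F a); last by exists (p n).
  by exists (SigSub (mem_set Fa)).
have [lift liftK] := choice lift_ex.
have ln0 := lam0 n.
have scaled (a b : riemann_sphere R) :
    ((lam n)^-1 * mdist a b < r) = (mdist a b < lam n * r).
  by rewrite mulrC ltr_pdivrMr// [r * _]mulrC.
have lift_lt a : F a -> mdist (\val (p n)) a < lam n * r ->
    (lam n)^-1 * mdist (\val (p n)) (\val (lift a)) < r.
  by move=> Fa ar; rewrite liftK// scaled.
exists (\val (p n)), (lam n), (phi \o lift); split.
- exact: set_valP.
- by rewrite ln0/=; move: nk; rewrite gtr0_norm.
- move=> y /dense[x px xy]; have Fx : F (\val x) by exact: set_valP.
  exists (\val x) => //; split; first by rewrite -scaled.
  by rewrite /= (_ : lift (\val x) = x)//; apply: val_inj; exact: liftK.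
- move=> a Fa pa.
  have pp : (lam n)^-1 * mdist (\val (p n)) (\val (p n)) < r.
    by rewrite mdistxx mulr0; lra.
  have := isom (p n) (lift a) pp (lift_lt a Fa pa).
  by rewrite /= phip liftK// mulrC ltr_norml => /andP[? ?]; split; lra.
- move=> a b Fa Fb pa pb.
  have := isom (lift a) (lift b) (lift_lt a Fa pa) (lift_lt b Fb pb).
  by rewrite /= !liftK// mulrC ltr_norml => /andP[? ?]; split; lra.
Qed.

(** The ball is approximated by a small piece of [F], and the grid squares of a chart colour it. *)
Lemma tangent_cball_compact (rho : R) : compact (cball q rho).
Proof.
apply: finitely_covered_compact; first exact: closed_cball.
move=> eta eta0.
pose r := Num.max 1 (rho + 1).
have r1 : 1 <= r by rewrite le_max lexx.
have rhor : rho < r by rewrite lt_max ltrDl ltr01 orbT.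
have e0 : 0 < eta / 4 by rewrite divr_gt0.
have k0 : 0 < 1 / (4 * r) by rewrite divr_gt0// mulr_gt0// (lt_le_trans ltr01).
have [p [l [f [Fp /andP[l0 lk] dense _ isom]]]] := tangent_approximation k0 e0 r1.
have lr4 : l * r < 1 / 4.
  move: lk; rewrite ltr_pdivlMr; last by rewrite mulr_gt0// (lt_le_trans ltr01).
  lra.
have [phi [phip phiP]] := sphere_chart p.
(* The chart turns [h] into [3 * h], which becomes [eta / 4] after rescaling. The other three
   quarters are the approximation errors at [y] and [z] and the distortion of [f]. *)
pose h := l * eta / 12; have h0 : 0 < h by rewrite divr_gt0// mulr_gt0.
pose M := Num.bound (1 / 4 / h).
have Mh : 1 / 4 <= M%:R * h.
  by rewrite -ler_pdivrMr//; apply/ltW/archi_boundP; rewrite divr_ge0 ?ltW.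
have [g gP] := @grid_classes R h M h0.
have near_ex y : exists a, mdist q y <= rho ->
    [/\ F a, mdist p a < l * r & mdist (f a) y < eta / 4].
  have [yr|yr] := lerP (mdist q y) rho; last by exists p => ?; lra.
  by have [a Fa [pa ay]] := dense y (le_lt_trans yr rhor); exists a.
have [a aP] := choice near_ex.
have phi_le b : mdist p b < l * r -> `|phi b| <= M%:R * h.
  move=> br; have p4 : mdist p p <= 1 / 4 by rewrite mdistxx; lra.
  have b4 : mdist p b <= 1 / 4 by lra.
  have [+ _] := phiP _ _ p4 b4; rewrite phip sub0r normrN.
  by move=> h1; apply: (le_trans h1); exact: le_trans Mh.
exists _, (fun y => g (phi (a y))) => y z /aP[Fy py ay] /aP[Fz pz az].
move=> /(gP _ _ (phi_le _ py) (phi_le _ pz)) yz.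
have y4 : mdist p (a y) <= 1 / 4 by lra.
have z4 : mdist p (a z) <= 1 / 4 by lra.
have [_ d3] := phiP _ _ y4 z4.
have dl : mdist (a y) (a z) / l <= eta / 4.
  rewrite ler_pdivrMr//; apply: (le_trans d3).
  have -> : eta / 4 * l = 3 * h by rewrite /h; field.
  by rewrite ler_pM2l.
have [fyz _] := isom _ _ Fy Fz py pz.
have := metric_triangle y (f (a y)) z; have := metric_triangle (f (a y)) (f (a z)) z.
rewrite [mdist y (f _)]metric_sym; lra.
Qed.

End Transfer.

(** * Counting the components *)

Lemma distinct_elements (U : choiceType) (A : set U) (N : nat) :
  ~ (A #<= `I_N)%card ->
  exists2 y : 'I_N.+1 -> U, injective y & forall i, A (y i).
Proof.
move=> AN.
have [B BA cardB] : exists2 B : {fset U}, [set` B] `<=` A & (N < #|` B|)%N.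
  have [/finite_fsetP[B AB]|infA] := pselect (finite_set A);
    last exact: infinite_set_fset infA.
  exists B; first by rewrite AB.
  rewrite ltnNge; apply/negP => BN; apply: AN.
  by rewrite AB (card_le_eql (introT card_eq_fsetP erefl)) card_le_II.
have [d dB] : exists d, d \in B by apply/fset0Pn; rewrite -cardfs_gt0 (leq_trans _ cardB).
have iB (i : 'I_N.+1) : (i < size (enum_fset B))%N by apply: leq_trans cardB.
exists (fun i => nth d (enum_fset B) i).
  move=> i j /eqP; rewrite nth_uniq ?fset_uniq// => /eqP.
  exact: val_inj.
by move=> i; apply: BA; exact: mem_nth.
Qed.

Theorem theorem5p6 (R : realType) (L : R) (L1 : 1 <= L) :
  exists N : nat,
    forall Omega : set (riemann_sphere R),
      john_domain L Omega -> connected (boundary Omega) ->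
      forall (Y : completeMetricType R) (q : Y),
        weak_tangent
          (fun x y : boundary Omega => mdist (\val x) (\val y)) q ->
        (components Y #<= `I_N)%card.
Proof.
have [N linked] := linked_boundary_points L1.
exists N => Omega jO cF Y q wt.
have [kappa k0 {}linked] := linked Omega jO cF.
apply: contrapT => /distinct_elements[c c_inj cY].
have y_ex i : exists y, connected_component [set: Y] y = c i.
  by have [y _ <-] := cY i; exists y.
have [y yc] := choice y_ex.
pose r0 := \big[Num.max/1]_i (mdist q (y i) + 1).
have r0y i : mdist q (y i) + 1 <= r0 by exact: le_bigmax.
have r01 : 1 <= r0 by exact: bigmax_ge_id.
have L0 : 0 < L by lra.
(* The linking ball for [t = l * (r0 + 1)], rescaled by [l], with a margin of 1 for the
   approximation errors. *)
pose rho := 40 * (L * (r0 + 1)) + 1.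
have Lr : 1 * (r0 + 1) <= L * (r0 + 1) by rewrite ler_pM2r//; lra.
have rho1 : 1 <= rho by rewrite /rho; lra.
have pairs eps : 0 < eps -> exists ij : 'I_N.+1 * 'I_N.+1, ij.1 != ij.2 /\
    chain mdist (cball q rho) eps (y ij.1) (y ij.2).
  move=> eps0; pose eta := Num.min (eps / 2) (1 / 2).
  have eta0 : 0 < eta by rewrite lt_min divr_gt0//= divr_gt0.
  have eta1 : eta <= eps / 2 by rewrite ge_min lexx.
  have eta2 : eta <= 1 / 2 by rewrite ge_min lexx orbT.
  have k1 : 0 < kappa / (r0 + 1) by rewrite divr_gt0//; lra.
  have [p [l [f [Fp /andP[l0 lk] dense rad isom]]]] :=
    tangent_approximation wt k1 eta0 rho1.
  have near_ex i : exists a, [/\ boundary Omega a, mdist p a < l * rho &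
      mdist (f a) (y i) < eta].
    have [|a Fa [pa ay]] := dense (y i); last by exists a.
    by have := r0y i; rewrite /rho; lra.
  have [x xP] := choice near_ex.
  have xt i : boundary Omega (x i) /\ mdist p (x i) < l * (r0 + 1).
    have [Fx px xy] := xP i; split => //.
    have [_] := rad _ Fx px.
    have := metric_triangle q (y i) (f (x i)); rewrite [mdist (y i) _]metric_sym.
    have := r0y i => h1 h2 h3.
    have : mdist p (x i) / l < r0 + 1 by lra.
    by rewrite ltr_pdivrMr// mulrC.
  have tk : 0 < l * (r0 + 1) <= kappa.
    rewrite mulr_gt0//=; last by lra.
    by move: lk; rewrite ltr_pdivlMr; [lra|lra].
  (* Steps of length [l * eta] become [eta] in the tangent, and the distortion adds at most another
     [eta], within [eps] in total. *)
  have [i [j [ij xij]]] := linked p _ x Fp tk xt (l * eta) (mulr_gt0 l0 eta0).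
  exists (i, j); split => //=.
  have in_ball a : boundary Omega a -> mdist p a <= 40 * (L * (l * (r0 + 1))) ->
      mdist p a < l * rho /\ cball q rho (f a).
    move=> Fa pa.
    have pa' : mdist p a < l * rho by rewrite /rho; lra.
    split=> //; have [h1 _] := rad _ Fa pa'.
    have : mdist p a / l <= 40 * (L * (r0 + 1)) by rewrite ler_pdivrMr//; lra.
    by rewrite /cball /= /rho; lra.
  have yb k : cball q rho (y k) by have := r0y k; rewrite /cball /= /rho; lra.
  have xb k : cball q rho (f (x k)).
    have [Fx _ xy] := xP k; rewrite /cball /=.
    have := metric_triangle q (y k) (f (x k)); rewrite [mdist (y k) _]metric_sym.
    by have := r0y k; rewrite /rho; lra.
  have xy k : chain mdist (cball q rho) eps (f (x k)) (y k).
    by apply: chain_step => //; have [_ _ ?] := xP k; lra.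
  apply: (chain_trans (y := f (x i))).
    by apply: chain_sym (xy i); exact: metric_sym.
  apply: chain_trans (xy j).
  apply: chain_map xij => [a [Fa pa]|a b [Fa pa] [Fb pb] ab].
    exact: (in_ball _ Fa pa).2.
  have [ra _] := in_ball _ Fa pa; have [rb _] := in_ball _ Fb pb.
  have [h1 _] := isom _ _ Fa Fb ra rb.
  have : mdist a b / l <= eta by rewrite ler_pdivrMr// mulrC.
  lra.
(* The pair found depends on [eps]. There are finitely many pairs, and a chain at a small scale is
   one at every larger scale, so one pair serves all scales. *)
have [[i j] [ij yij]] : exists ij : 'I_N.+1 * 'I_N.+1, ij.1 != ij.2 /\
    forall eps : R, 0 < eps -> chain mdist (cball q rho) eps (y ij.1) (y ij.2).
  apply: contrapT => none.
  have [||e e0 eP] := @finite_common_pos R _ (fun (ij : 'I_N.+1 * 'I_N.+1) e =>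
    ij.1 != ij.2 -> ~ chain mdist (cball q rho) e (y ij.1) (y ij.2)).
  - move=> ij; apply: contrapT => nij; apply: none; exists ij; split.
      apply/negP => /eqP eq; apply: nij; exists 1 => //.
      by rewrite eq eqxx.
    move=> eps eps0; apply: contrapT => ne; apply: nij; exists eps => //.
  - by move=> ij e e' ee' H /H nch ch; apply: nch; exact: chain_sub ch.
  by have [ij [ne ch]] := pairs e e0; exact: (eP ij ne ch).
have := chained_same_component (@tangent_cball_compact _ _ _ _ wt rho) yij.
rewrite /= !yc => /c_inj eq; move: ij; by rewrite /= eq eqxx.
Qed.
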